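(* Let $\Omega \subset \mathbb{C}$ be a domain and let $V \subset \Omega$ be an open set such that $\overline{V} \cap \partial\Omega \neq \emptyset$. Assume that for every $\zeta \in \overline{V} \cap \partial\Omega$ there exists a sequence $(w_n)_{n\in\mathbb{N}}$ contained in $\mathbb{C}\setminus\overline{\Omega}$ with $w_n \to \zeta$. Let $X(\Omega,V)=\{f\in H(\Omega): f|_V \text{ is bounded}\}$. Then $\Omega$ is an $X(\Omega,V)$-domain of holomorphy, and the set $\{f \in X(\Omega,V): f \text{ is non-extendable}\}$ is dense and $G_\delta$ in $X(\Omega,V)$.
   Context: A domain is a nonempty open connected set; $H(\Omega)$ is the set of holomorphic functions $f:\Omega\to\mathbb{C}$. Closures and boundaries are taken in $\mathbb{C}$. The space $X(\Omega,V)$ carries the Fréchet topology induced by the seminorms $\|f|_{K_m}\|_\infty$, $m=1,2,\dots$, and $\|f|_V\|_\infty$, where $\{K_m\}_{m\ge 1}$ is an exhaustive sequence of compact subsets of $\Omega$ (increasing, and every compact subset of $\Omega$ is contained in some $K_m$). A holomorphic function $f:\Omega\to\mathbb{C}$ is extendable if there exist an open connected set $U\subset\mathbb{C}$ with $U\cap\Omega\neq\emptyset$ and $U\cap\Omega^{\mathrm c}\neq\emptyset$, a holomorphic function $F:U\to\mathbb{C}$ and a connected component $W$ of $U\cap\Omega$ such that $F|_W=f|_W$. Otherwise $f$ is non-extendable. For $X\subset H(\Omega)$, $\Omega$ is called an $X$-domain of holomorphy if there exists $f\in X$ which is non-extendable. *)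

(* Defs.v *)
From HB Require Import structures.
From mathcomp Require Import all_boot all_order all_algebra.
From mathcomp Require Import all_classical all_reals all_analysis.
From mathcomp Require Import borel_hierarchy complex.
Set Implicit Arguments.
Unset Strict Implicit.
Unset Printing Implicit Defensive.
Import Order.TTheory GRing.Theory Num.Theory numFieldNormedType.Exports.
Local Open Scope classical_set_scope.
Local Open Scope ring_scope.
Local Open Scope complex_scope.

(* The complex numbers over [R], as a normed space over themselves: [R[i]] only
   carries a topology through its regular-algebra alias, and [derivable _ z 1]
   at this type is complex differentiability. *)
Notation Cplx R := (R[i]^o).

Section ComplexAnalysis.
Context {R : realType}.
Implicit Types (Omega U V W : set (Cplx R)) (f F : Cplx R -> Cplx R).

Definition boundary (A : set (Cplx R)) : set (Cplx R) := closure A `\` A°.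

Definition domain Omega := [/\ Omega !=set0, open Omega & connected Omega].

Definition holomorphic_on U f := forall z : Cplx R, U z -> derivable f z 1.

(* Functions on [Omega] are represented by total functions that vanish outside
   [Omega], so that equality in the function space is equality on [Omega]. *)
Definition holfun Omega : set (Cplx R -> Cplx R) :=
  [set f | holomorphic_on Omega f /\ forall z, ~ Omega z -> f z = 0].

Definition bdd_holfun Omega V : set (Cplx R -> Cplx R) :=
  holfun Omega `&` [set f | [bounded f z | z in V]].

Definition is_component (A W : set (Cplx R)) :=
  exists2 z, A z & W = connected_component A z.

Definition extendable Omega f :=
  exists U F W,
    [/\ open U, connected U, U `&` Omega !=set0 & U `&` ~` Omega !=set0] /\
    [/\ holomorphic_on U F, is_component (U `&` Omega) W &
        forall z, W z -> F z = f z].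

Definition domain_of_holomorphy (X : set (Cplx R -> Cplx R)) Omega :=
  exists2 f, X f & ~ extendable Omega f.

Definition exhaustive Omega (K : nat -> set (Cplx R)) :=
  [/\ forall m, compact (K m) /\ K m `<=` Omega,
      forall m, K m `<=` K m.+1 &
      forall L, compact L -> L `<=` Omega -> exists m, L `<=` K m].

(* [normc] is the modulus with values in [R] rather than in [R[i]].  On a
   nonempty [A] this is the supremum of [|f|] on [A]; on the empty set it is
   [-oo], which puts no constraint on [f] in [X_nbhs]. *)
Definition supnorm (A : set (Cplx R)) f : \bar R :=
  ereal_sup [set (ComplexField.Normc.normc (f z))%:E | z in A].

End ComplexAnalysis.

(* The space X(Omega, V); the parameter [K] determines its topology. *)
Definition Xspace (R : realType) (Omega V : set (Cplx R))
  (K : nat -> set (Cplx R)) : Type := set_type (bdd_holfun Omega V).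

Section XTopology.
Context {R : realType} (Omega V : set (Cplx R)) (K : nat -> set (Cplx R)).
Local Notation X := (Xspace Omega V K).

Definition Xfun (f : X) : Cplx R -> Cplx R := \val f.

HB.instance Definition _ := Choice.copy X (set_type (bdd_holfun Omega V)).

Definition X_ball (f : X) (n : nat) (e : R) : set X :=
  [set g : X |
    (forall m, (m < n)%N -> (supnorm (K m) (Xfun g \- Xfun f)%R < e%:E)%E) /\
    (supnorm V (Xfun g \- Xfun f)%R < e%:E)%E].

Definition X_nbhs (f : X) : set_system X :=
  [set B | exists n e, 0 < e /\ X_ball f n e `<=` B].

HB.instance Definition _ := hasNbhs.Build X X_nbhs.

Lemma supnormB0 (A : set (Cplx R)) (f : Cplx R -> Cplx R) (e : R) :
  0 < e -> (supnorm A (f \- f)%R < e%:E)%E.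
Proof.
move=> e0; apply: (@le_lt_trans _ _ 0%E); last by rewrite lte_fin.
apply: ge_ereal_sup => _ [z _ <-].
by rewrite /= subrr ComplexField.Normc.normc0.
Qed.

Lemma supnorm_split (A : set (Cplx R)) (f g h : Cplx R -> Cplx R) (e : R) :
  (supnorm A (g \- h)%R < (e / 2)%:E)%E -> (supnorm A (h \- f)%R < (e / 2)%:E)%E ->
  (supnorm A (g \- f)%R < e%:E)%E.
Proof.
move=> gh hf.
apply: (@le_lt_trans _ _ (supnorm A (g \- h)%R + supnorm A (h \- f)%R)%E); last first.
  by rewrite [e]splitr EFinD lteD.
apply: ge_ereal_sup => _ [z Az <-].
apply: (@le_trans _ _ ((ComplexField.Normc.normc ((g \- h)%R z))%:E
   + (ComplexField.Normc.normc ((h \- f)%R z))%:E)%E).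
  rewrite -EFinD lee_fin /=.
  have -> : g z - f z = (g z - h z) + (h z - f z) by rewrite addrA subrK.
  exact: le_normcD.
by apply: leeD; apply: ereal_sup_ubound; exists z.
Qed.

Lemma X_ball_refl (f : X) n (e : R) : 0 < e -> X_ball f n e f.
Proof. by move=> e0; split=> [m _|]; exact: supnormB0. Qed.

Fact X_nbhs_filter (f : X) : ProperFilter (nbhs f).
Proof.
apply: Build_ProperFilter_ex.
  by move=> B [n [e [e0 sB]]]; exists f; apply/sB/X_ball_refl.
split.
- by exists 0%N, 1; split.
- move=> A B [n [e [e0 sA]]] [m [d [d0 sB]]].
  exists (maxn n m), (Num.min e d); split; first by rewrite lt_min e0.
  move=> g [gK gV]; split; [apply: sA | apply: sB]; split.
  + move=> k kn; have := gK k; rewrite leq_max kn => /(_ isT) /lt_le_trans.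
    by apply; rewrite lee_fin ge_min lexx.
  + by apply: (lt_le_trans gV); rewrite lee_fin ge_min lexx.
  + move=> k kn; have := gK k; rewrite leq_max kn orbT => /(_ isT) /lt_le_trans.
    by apply; rewrite lee_fin ge_min lexx orbT.
  + by apply: (lt_le_trans gV); rewrite lee_fin ge_min lexx orbT.
- by move=> A B AB [n [e [e0 sA]]]; exists n, e; split=> // g /sA/AB.
Qed.

Fact X_nbhs_singleton (f : X) (A : set X) : nbhs f A -> A f.
Proof. by move=> [n [e [e0 sA]]]; apply/sA/X_ball_refl. Qed.

Fact X_nbhs_nbhs (f : X) (A : set X) : nbhs f A -> nbhs f (nbhs^~ A).
Proof.
move=> [n [e [e0 sA]]]; exists n, (e / 2); split; first by rewrite divr_gt0.
move=> h [hK hV]; exists n, (e / 2); split; first by rewrite divr_gt0.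
move=> g [gK gV]; apply: sA; split.
- by move=> m mn; exact: supnorm_split (gK m mn) (hK m mn).
- exact: supnorm_split gV hV.
Qed.

HB.instance Definition _ := Nbhs_isNbhsTopological.Build X
  X_nbhs_filter X_nbhs_singleton X_nbhs_nbhs.

End XTopology.

(* Main.v *)
Require Import Defs.
From HB Require Import structures.
From mathcomp Require Import all_boot all_order all_algebra.
From mathcomp Require Import all_classical all_reals all_analysis.
From mathcomp Require Import borel_hierarchy complex.
From mathcomp Require Import ring lra.
Import Order.TTheory GRing.Theory Num.Theory numFieldNormedType.Exports.
Set Implicit Arguments.
Unset Strict Implicit.
Unset Printing Implicit Defensive.
Local Open Scope classical_set_scope.
Local Open Scope ring_scope.

(** A holomorphic function [f] is extendable exactly when, for some disc [D(q, r)]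
    with center in [Omega] that meets the complement of [Omega], its Taylor
    coefficients at [q] satisfy [|c_k| r ^ k <= M] for all [k].  Indeed an
    extension is holomorphic near a boundary point [p] of the component [W], so
    that Cauchy's estimates at a point [q] of [W] close to [p] give the bound
    ([coef_bounded_of_extendable]); conversely the Taylor series then converges
    on [D(q, r)] and extends [f] by the identity theorem
    ([extendable_of_coef_bounded]).  Rational [q] and [r] and integral [M] are
    enough, so there are countably many such conditions.

    Each condition is closed, as Taylor coefficients depend continuously on the
    function: hence non-extendability is a G-delta property
    ([nonextendable_Gdelta]).  Each condition is also violated arbitrarily close
    to any function.  There is a point [w] of [D(q, r)] that is neither in
    [Omega] nor in the closure of [V]: a point of the disc outside [Omega] that
    belongs to the closure of [V] is a boundary point, hence a limit of exterior
    points, which are not in the closure of [V] ([pole_position]).  The function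
    [1 / (z - w)] is holomorphic on [Omega] and bounded on [V], and its
    coefficients at [q] are [- 1 / (w - q) ^ (k + 1)], with [|w - q| < r].
    Adding a small multiple of it violates the condition, and a gliding hump
    over all conditions produces a non-extendable function as close as desired
    to a given one ([nonextendable_near]); this gives density, and existence
    when starting from 0.

    The function theory behind this is built on contour integrals over
    rectangles ([rectint]): Goursat's lemma, Cauchy's formula on squares and
    Taylor expansions with remainder ([taylor]).  Squares avoid the complex
    exponential, and the loss of a constant factor against discs is harmless
    since radii only matter up to a constant.  Coefficients are handled through
    asymptotic expansions ([aexp]), which are unique, linear and local. *)

(** * Real moduli and complex differentiability *)

Local Notation normc := ComplexField.Normc.normc.

Section Modulus.
Context {R : realType}.
Implicit Types (x y z w : R[i]) (r : R).

Lemma normc_ge0 z : 0 <= normc z.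
Proof. by case: z => a b; exact: sqrtr_ge0. Qed.

Lemma normc_eq0 z : (normc z == 0) = (z == 0).
Proof.
apply/eqP/eqP => [/ComplexField.Normc.eq0_normc//|->].
exact: ComplexField.Normc.normc0.
Qed.

Lemma normc_gt0 z : (0 < normc z) = (z != 0).
Proof. by rewrite lt_def normc_ge0 normc_eq0 andbT. Qed.

Lemma normcD z w : normc (z + w) <= normc z + normc w.
Proof. exact: le_normcD. Qed.

Lemma normcBC z w : normc (z - w) = normc (w - z).
Proof. by rewrite -normcN opprB. Qed.

Lemma normcB z w : normc (z - w) <= normc z + normc w.
Proof. by rewrite -[normc w]normcN; exact: normcD. Qed.

Lemma normcBB z w : normc z - normc w <= normc (z - w).
Proof. by rewrite lerBlDr -[X in normc X <= _](subrK w) normcD. Qed.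

Lemma normc_dist w z z' : normc (z - z') <= normc (z - w) + normc (w - z').
Proof. by rewrite -[z - z'](subrKA w) normcD. Qed.

Lemma normcM z w : normc (z * w) = normc z * normc w.
Proof. exact: ComplexField.Normc.normcM. Qed.

Lemma normcV z : normc z^-1 = (normc z)^-1.
Proof. exact: ComplexField.Normc.normcV. Qed.

Lemma normcX z n : normc (z ^+ n) = normc z ^+ n.
Proof.
elim: n => [|n IH]; first by rewrite !expr0 ComplexField.Normc.normc1.
by rewrite !exprS normcM IH.
Qed.

Lemma normc_real r : normc r%:C%C = `|r|.
Proof. by rewrite /= expr0n /= addr0 sqrtr_sqr. Qed.

Lemma normc_i : normc ('i%C : R[i]) = 1.
Proof. by rewrite /= expr0n /= expr1n add0r sqrtr1. Qed.

Lemma normr_normc z : `|z| = (normc z)%:C%C.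
Proof. by case: z. Qed.

Lemma Re_le_normc z : `|complex.Re z| <= normc z.
Proof. by case: z => a b /=; rewrite -sqrtr_sqr ler_wsqrtr// lerDl sqr_ge0. Qed.

Lemma Im_le_normc z : `|complex.Im z| <= normc z.
Proof. by case: z => a b /=; rewrite -sqrtr_sqr ler_wsqrtr// lerDr sqr_ge0. Qed.

Lemma normc_le_ReIm z : normc z <= `|complex.Re z| + `|complex.Im z|.
Proof.
rewrite {1}(complexE z) (le_trans (normcD _ _))// normcM normc_i mul1r.
by rewrite !normc_real.
Qed.

(** Estimates are proved up to a multiple [c * e] of an arbitrary small [e];
    this spares dividing [e] by [c] beforehand, and lets [e] be taken below 1. *)
Lemma ler_addsmall (a b c : R) :
  (forall e, 0 < e -> e < 1 -> a <= b + c * e) -> a <= b.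
Proof.
move=> H; apply/ler_addgt0Pr => e e0.
have d0 : 0 < `|c| + 1 by rewrite ltr_wpDl.
pose t := Num.min (e / (`|c| + 1)) (1 / 2).
have t0 : 0 < t by rewrite lt_min divr_gt0//=; lra.
have t1 : t < 1 by rewrite gt_min; apply/orP; right; lra.
apply: (le_trans (H _ t0 t1)); rewrite lerD2l.
apply: (@le_trans _ _ (`|c| * t)); first by rewrite ler_pM2r// ler_norm.
apply: (@le_trans _ _ ((`|c| + 1) * t)).
  by rewrite ler_pM2r// lerDl.
by rewrite mulrC -ler_pdivlMr// /t ge_min lexx.
Qed.

End Modulus.

Section CplxTopology.
Context {R : realType}.
Local Notation C := (Cplx R).
Implicit Types (z w : C) (A U : set C) (f g : C -> C).

Lemma nbhs_normcP z A :
  nbhs z A <-> exists2 e : R, 0 < e & forall w, normc (w - z) < e -> A w.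
Proof.
split.
  move=> /nbhs_ballP[e /= e0 sA].
  have eE : e = (complex.Re e)%:C%C by rewrite RRe_real// gtr0_real.
  exists (complex.Re e); first by rewrite -ltcR -eE.
  move=> w we; apply: sA; rewrite -ball_normE /=.
  by rewrite normr_normc normcBC eE ltcR.
move=> [e e0 sA]; apply/nbhs_ballP; exists e%:C%C; first by rewrite /= ltcR.
move=> w; rewrite -ball_normE /= normr_normc ltcR normcBC; exact: sA.
Qed.

Lemma open_normcP U : open U <->
  forall z, U z -> exists2 e : R, 0 < e & forall w, normc (w - z) < e -> U w.
Proof.
rewrite openE; split=> [H z Uz|H z /H]; first exact/nbhs_normcP/H.
by move/nbhs_normcP.
Qed.

Lemma closure_normcP A z :
  closure A z <-> forall e : R, 0 < e -> exists2 w, A w & normc (w - z) < e.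
Proof.
split=> [cl e e0|H B /nbhs_normcP[e e0 sB]].
  have [|w [Aw we]] := cl [set w | normc (w - z) < e].
    by apply/nbhs_normcP; exists e.
  by exists w.
by have [w Aw we] := H e e0; exists w; split=> //; exact: sB.
Qed.

Definition disc z (r : R) : set C := [set w | normc (w - z) < r].

Lemma disc_center z r : 0 < r -> disc z r z.
Proof. by rewrite /disc /= subrr ComplexField.Normc.normc0. Qed.

Lemma open_disc z r : open (disc z r).
Proof.
apply/open_normcP => w wr; exists (r - normc (w - z)); first by rewrite subr_gt0.
move=> w' ww'; rewrite /disc /=.
by apply: le_lt_trans (normc_dist w _ _) _; rewrite -ltrBrDr.
Qed.

Lemma cvg_normcP (u : nat -> C) z :
  u @ \oo --> z <->
  forall e : R, 0 < e -> \forall n \near \oo, normc (u n - z) < e.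
Proof.
split=> [cu e e0|H A /nbhs_normcP[e e0 sA]].
  have /cu : nbhs z (disc z e) by apply/nbhs_normcP; exists e.
  by [].
by near=> n; apply: sA; near: n; exact: H.
Unshelve. all: by end_near. Qed.

(** The limit of difference quotients taken with the real-valued modulus, and
    without division by [h]. *)
Definition cdiff f z (d : C) := forall e : R, 0 < e ->
  exists2 a : R, 0 < a &
  forall h, normc h < a -> normc (f (z + h) - f z - h * d) <= e * normc h.

Lemma cdiffP f z : derivable f z 1 <-> exists d, cdiff f z d.
Proof.
split.
  move=> /cvg_ex[d cd]; exists d => e e0.
  have : nbhs d (disc d e) by apply/nbhs_normcP; exists e.
  move=> /cd /nbhs_normcP[a a0 Ha]; exists a => // h ha.
  have [->|h0] := eqVneq h 0.
    by rewrite addr0 subrr mul0r subrr ComplexField.Normc.normc0 mulr0.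
  have := Ha h; rewrite subr0 => /(_ ha h0).
  rewrite /disc /= => /ltW le_e.
  rewrite -[X in normc X](_ : h * (h^-1 *: (f (h *: 1 + z) - f z) - d) = _).
    by rewrite normcM mulrC ler_wpM2r// normc_ge0.
  rewrite /GRing.scale /= mulr1 [h + z]addrC mulrBr mulVKf//.
move=> [d cd]; apply/cvg_ex; exists d => A /nbhs_normcP[e e0 sA].
have e20 : 0 < e / 2 by rewrite divr_gt0.
have [a a0 Ha] := cd _ e20.
apply/nbhs_normcP; exists a => // h; rewrite subr0 => ha h0; apply: sA.
have hn0 : 0 < normc h by rewrite normc_gt0.
rewrite -(ltr_pM2l hn0) -normcM /GRing.scale /= mulr1.
rewrite mulrBr mulVKf// addrC [h + z]addrC addrC.
apply: le_lt_trans (Ha h ha) _; rewrite mulrC ltr_pM2l//.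
by rewrite ltr_pdivrMr// mulr_natr mulr2n ltrDl.
Qed.

Lemma derivable_continuous f z : derivable f z 1 -> {for z, continuous f}.
Proof. by move/derivable1_diffP/differentiable_continuous. Qed.

Lemma near_derivable f g z (r : R) : 0 < r ->
  (forall w, normc (w - z) < r -> f w = g w) -> derivable f z 1 -> derivable g z 1.
Proof.
move=> r0 fg /cdiffP[d cd]; apply/cdiffP; exists d => e e0.
have [a a0 Ha] := cd e e0; exists (Num.min a r); first by rewrite lt_min a0.
move=> h; rewrite lt_min => /andP[ha hr].
rewrite -!fg ?subrr ?ComplexField.Normc.normc0 ?Ha//.
by rewrite [z + h]addrC addrK.
Qed.

End CplxTopology.

(** * Integrals of complex-valued functions on segments *)

Section Integral.
Context {R : realType}.
Local Notation C := (Cplx R).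
Local Notation mu := (@lebesgue_measure R).
Local Notation Re := (@complex.Re R).
Local Notation Im := (@complex.Im R).
Implicit Types (u v : R -> C) (a b c : R).

Lemma continuous_Re : continuous (Re : C -> R).
Proof.
move=> z A /nbhs_ballP[e /= e0 sA]; apply/nbhs_normcP; exists e => // w we.
apply: sA; rewrite -ball_normE /=; apply: le_lt_trans we.
by rewrite normcBC; apply: le_trans (Re_le_normc _); rewrite raddfB.
Qed.

Lemma continuous_Im : continuous (Im : C -> R).
Proof.
move=> z A /nbhs_ballP[e /= e0 sA]; apply/nbhs_normcP; exists e => // w we.
apply: sA; rewrite -ball_normE /=; apply: le_lt_trans we.
by rewrite normcBC; apply: le_trans (Im_le_normc _); rewrite raddfB.
Qed.

(** Continuity at the end points is two-sided: the integrands below restrict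
    functions that are continuous on a neighbourhood of the segment. *)
Definition continuous_on u a b := forall x, a <= x <= b -> {for x, continuous u}.

Lemma continuous_integrable (v : R -> R) a b :
  (forall x, a <= x <= b -> {for x, continuous v}) ->
  mu.-integrable `[a, b] (EFin \o v).
Proof.
move=> cv; apply: continuous_compact_integrable; first exact: segment_compact.
apply: continuous_in_subspaceT => x; rewrite inE /= in_itv /=; exact: cv.
Qed.

Definition cint u a b : C :=
  Complex (\int[mu]_(x in `[a, b]) Re (u x))%R (\int[mu]_(x in `[a, b]) Im (u x))%R.

Lemma integrable_Re u a b : continuous_on u a b ->
  mu.-integrable `[a, b] (EFin \o (Re \o u)).
Proof.
move=> cu; apply: continuous_integrable => x /cu ux.
by apply: continuous_comp ux _; exact: continuous_Re.
Qed.

Lemma integrable_Im u a b : continuous_on u a b ->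
  mu.-integrable `[a, b] (EFin \o (Im \o u)).
Proof.
move=> cu; apply: continuous_integrable => x /cu ux.
by apply: continuous_comp ux _; exact: continuous_Im.
Qed.

Lemma eq_cint u v a b : (forall x, a <= x <= b -> u x = v x) ->
  cint u a b = cint v a b.
Proof.
by move=> uv; congr Complex; apply: eq_Rintegral => x;
  rewrite inE /= in_itv /= => /uv ->.
Qed.

Lemma cintD u v a b : continuous_on u a b -> continuous_on v a b ->
  cint (fun x => u x + v x) a b = cint u a b + cint v a b.
Proof.
move=> cu cv; rewrite /cint; apply/eqP; rewrite eq_complex /=.
rewrite -!RintegralD//; do ?[exact: integrable_Re|exact: integrable_Im].
by apply/andP; split; apply/eqP; apply: eq_Rintegral => x _; rewrite raddfD.
Qed.

Lemma cintZ (k : C) u a b : continuous_on u a b ->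
  cint (fun x => k * u x) a b = k * cint u a b.
Proof.
move=> cu; rewrite /cint; case: k => p q; apply/eqP; rewrite eq_complex /=.
have iZ (r : R) (w : R -> R) : mu.-integrable `[a, b] (EFin \o w) ->
    mu.-integrable `[a, b] (EFin \o (fun x => r * w x)).
  move=> iw; apply: eq_integrable (integrableZl _ r iw) => //.
have iR := integrable_Re cu; have iI := integrable_Im cu.
apply/andP; split; apply/eqP.
  rewrite -!RintegralZl// -RintegralB//; [|exact: (iZ _ _ iR)|exact: (iZ _ _ iI)].
  by apply: eq_Rintegral => x _; case: (u x).
rewrite -!RintegralZl// -RintegralD//; [|exact: (iZ _ _ iI)|exact: (iZ _ _ iR)].
by apply: eq_Rintegral => x _; case: (u x) => ? ? /=; ring.
Qed.

Lemma Rint_split (v : R -> R) a b c : a <= b -> b <= c ->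
  mu.-integrable `[a, c] (EFin \o v) ->
  \int[mu]_(x in `[a, c]) v x =
  (\int[mu]_(x in `[a, b]) v x + \int[mu]_(x in `[b, c]) v x)%R.
Proof.
move=> ab bc iv; apply/eqP; rewrite addrC -subr_eq; apply/eqP.
rewrite Rintegral_itvB//.
rewrite Rintegral_itv_obnd_cbnd//.
apply: integrableS iv => //.
by apply: subset_itvr; rewrite ?bnd_simp.
Qed.

Lemma cint_split u a b c : a <= b -> b <= c -> continuous_on u a c ->
  cint u a c = cint u a b + cint u b c.
Proof.
move=> ab bc cu; rewrite /cint; apply/eqP; rewrite eq_complex /=.
rewrite (Rint_split ab bc) ?(Rint_split (v := Im \o u) ab bc) ?eqxx//.
  exact: integrable_Im.
exact: integrable_Re.
Qed.

Lemma Rint_bounds (v : R -> R) a b (m M : R) : a <= b ->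
  mu.-integrable `[a, b] (EFin \o v) ->
  (forall x, a <= x <= b -> m <= v x <= M) ->
  m * (b - a) <= (\int[mu]_(x in `[a, b]) v x)%R <= M * (b - a).
Proof.
move=> ab iv bv.
have ic (r : R) : mu.-integrable `[a, b] (EFin \o (fun=> r)).
  by apply: continuous_integrable => x _; exact: cvg_cst.
have muab : fine (mu `[a, b]%classic) = b - a.
  rewrite lebesgue_measure_itv /= lte_fin; case: ltP => // ba.
  by rewrite (_ : a = b) ?subrr//; apply/le_anti; rewrite ab.
rewrite -muab -!Rintegral_cst//.
by apply/andP; split; apply: le_Rintegral => // x; rewrite /= in_itv /= => /bv/andP[].
Qed.

(** One estimate gives the integrals of constants ([m = 0]), the bound of an
    integral ([c = 0]) and the effect of a small perturbation.  The factor 2 is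
    the price of estimating the two real coordinates separately. *)
Lemma cint_near u a b (c : C) (m : R) : a <= b -> continuous_on u a b ->
  (forall x, a <= x <= b -> normc (u x - c) <= m) ->
  normc (cint u a b - c * (b - a)%:C%C) <= 2 * m * (b - a).
Proof.
move=> ab cu bu.
have /(_ _)/andP[|R1 R2] := (@Rint_bounds (Re \o u) a b (Re c - m) (Re c + m) ab
  (integrable_Re cu)).
  move=> x /bu /(le_trans (Re_le_normc _)); rewrite raddfB /= ler_norml.
  by move=> /andP[? ?]; apply/andP; split; lra.
have /(_ _)/andP[|I1 I2] := (@Rint_bounds (Im \o u) a b (Im c - m) (Im c + m) ab
  (integrable_Im cu)).
  move=> x /bu /(le_trans (Im_le_normc _)); rewrite raddfB /= ler_norml.
  by move=> /andP[? ?]; apply/andP; split; lra.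
apply: le_trans (normc_le_ReIm _) _.
case: c {bu} R1 R2 I1 I2 => p q /= R1 R2 I1 I2.
rewrite !mulr0 !subr0 !add0r -mulrA mulr_natl mulr2n.
by apply: lerD; rewrite ler_norml; apply/andP; split; lra.
Qed.

End Integral.

(** * Contour integrals over rectangles and Goursat's lemma *)

Section Rectangles.
Context {R : realType}.
Local Notation C := (Cplx R).
Local Notation Re := (@complex.Re R).
Local Notation Im := (@complex.Im R).
Implicit Types (f g : C -> C) (z w : C) (x y : R).

Definition rect x0 x1 y0 y1 : set C :=
  [set z | x0 <= Re z <= x1 /\ y0 <= Im z <= y1].

Definition rect_bd x0 x1 y0 y1 : set C :=
  [set z | rect x0 x1 y0 y1 z /\ ~ (x0 < Re z < x1 /\ y0 < Im z < y1)].

(** The contour integral of [f dz] along the positively oriented boundary;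
    opposite edges are paired so that the constant part of [f] cancels under
    the integral sign and the linear part leaves constant integrands. *)
Definition rectint f x0 x1 y0 y1 : C :=
  cint (fun x => f (Complex x y0) - f (Complex x y1)) x0 x1 +
  'i%C * cint (fun y => f (Complex x1 y) - f (Complex x0 y)) y0 y1.

Lemma rect_bdP x0 x1 y0 y1 x y : x0 <= x <= x1 -> y0 <= y <= y1 ->
  (x = x0 \/ x = x1) \/ (y = y0 \/ y = y1) ->
  rect_bd x0 x1 y0 y1 (Complex x y).
Proof.
move=> hx hy e; split; first by split.
move=> [/= /andP[a b] /andP[c d]].
by case: e => -[] e; rewrite e ltxx in a b c d.
Qed.

Lemma continuous_hline y : continuous ((fun x => Complex x y) : R -> C).
Proof.
move=> x A /nbhs_normcP[e e0 sA]; apply/nbhs_ballP; exists e => // x' xx'.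
apply: sA; apply: le_lt_trans (normc_le_ReIm _) _ => /=.
by rewrite subrr normr0 addr0 distrC.
Qed.

Lemma continuous_vline x : continuous ((fun y => Complex x y) : R -> C).
Proof.
move=> y A /nbhs_normcP[e e0 sA]; apply/nbhs_ballP; exists e => // y' yy'.
apply: sA; apply: le_lt_trans (normc_le_ReIm _) _ => /=.
by rewrite subrr normr0 add0r distrC.
Qed.

Lemma cont_hline f x y : {for (Complex x y : C), continuous f} ->
  {for x, continuous (fun x => f (Complex x y))}.
Proof. by move=> cf; exact: (cvg_comp _ _ (@continuous_hline y x) cf). Qed.

Lemma cont_vline f x y : {for (Complex x y : C), continuous f} ->
  {for y, continuous (fun y => f (Complex x y))}.
Proof. by move=> cf; exact: (cvg_comp _ _ (@continuous_vline x y) cf). Qed.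

Definition cont_in f (A : set C) := forall z, A z -> {for z, continuous f}.

Lemma cont_edgeh f x0 x1 y0 y1 : y0 <= y1 -> cont_in f (rect_bd x0 x1 y0 y1) ->
  continuous_on (fun x => f (Complex x y0) - f (Complex x y1)) x0 x1.
Proof.
move=> hy cf x hx; apply: cvgB; apply: cont_hline; apply/cf/rect_bdP;
  rewrite ?lexx ?hy//; right; [by left|by right].
Qed.

Lemma cont_edgev f x0 x1 y0 y1 : x0 <= x1 -> cont_in f (rect_bd x0 x1 y0 y1) ->
  continuous_on (fun y => f (Complex x1 y) - f (Complex x0 y)) y0 y1.
Proof.
move=> hy cf y hx; apply: cvgB; apply: cont_vline; apply/cf/rect_bdP;
  rewrite ?lexx ?hy//; left; [by right|by left].
Qed.

Lemma rectint_splitx f x0 x1 x2 y0 y1 : x0 <= x1 -> x1 <= x2 -> y0 <= y1 ->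
  cont_in f (rect_bd x0 x1 y0 y1) -> cont_in f (rect_bd x1 x2 y0 y1) ->
  rectint f x0 x2 y0 y1 = rectint f x0 x1 y0 y1 + rectint f x1 x2 y0 y1.
Proof.
move=> h01 h12 hy c1 c2; rewrite /rectint (@cint_split _ _ _ x1)//; last first.
  move=> x /andP[hx0 hx2]; have [xx1|/ltW xx1] := leP x x1.
    by apply: cont_edgeh c1 _ _; rewrite ?hx0.
  by apply: cont_edgeh c2 _ _; rewrite ?xx1.
rewrite (@eq_cint _ (fun y => f (Complex x2 y) - f (Complex x0 y))
  (fun y => (f (Complex x2 y) - f (Complex x1 y)) +
            (f (Complex x1 y) - f (Complex x0 y)))); last first.
  by move=> y _; rewrite subrKA.
rewrite [X in _ + _ * X = _]cintD; [ring| exact: cont_edgev| exact: cont_edgev].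
Qed.

Lemma rectint_splity f x0 x1 y0 y1 y2 : x0 <= x1 -> y0 <= y1 -> y1 <= y2 ->
  cont_in f (rect_bd x0 x1 y0 y1) -> cont_in f (rect_bd x0 x1 y1 y2) ->
  rectint f x0 x1 y0 y2 = rectint f x0 x1 y0 y1 + rectint f x0 x1 y1 y2.
Proof.
move=> hx h01 h12 c1 c2; rewrite /rectint (@cint_split _ _ y0 y1)//; last first.
  move=> y /andP[hy0 hy2]; have [yy1|/ltW yy1] := leP y y1.
    by apply: cont_edgev c1 _ _; rewrite ?hy0.
  by apply: cont_edgev c2 _ _; rewrite ?yy1.
rewrite (@eq_cint _ (fun x => f (Complex x y0) - f (Complex x y2))
  (fun x => (f (Complex x y0) - f (Complex x y1)) +
            (f (Complex x y1) - f (Complex x y2)))); last first.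
  by move=> x _; rewrite subrKA.
rewrite [X in X + _ * _ = _]cintD; [ring| exact: cont_edgeh| exact: cont_edgeh].
Qed.

(** Affine functions have vanishing contour integral, so that only the
    distance from [f] to an affine function on the boundary counts. *)
Lemma rectint_near f x0 x1 y0 y1 (a b : C) (m : R) : x0 <= x1 -> y0 <= y1 ->
  cont_in f (rect_bd x0 x1 y0 y1) ->
  (forall z, rect_bd x0 x1 y0 y1 z -> normc (f z - (a + b * z)) <= m) ->
  normc (rectint f x0 x1 y0 y1) <= 4 * m * ((x1 - x0) + (y1 - y0)).
Proof.
move=> hx hy cf fm.
have near2 z z' : rect_bd x0 x1 y0 y1 z -> rect_bd x0 x1 y0 y1 z' ->
    normc ((f z - f z') - b * (z - z')) <= 2 * m.
  move=> /fm h1 /fm h2.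
  have -> : (f z - f z') - b * (z - z') =
    (f z - (a + b * z)) - (f z' - (a + b * z')) by ring.
  by apply: le_trans (normcB _ _) _; rewrite mulr_natl mulr2n lerD.
have H1 := @cint_near _ _ x0 x1 (b * Complex 0 (y0 - y1)) (2 * m) hx
  (cont_edgeh hy cf).
have H2 := @cint_near _ _ y0 y1 (b * Complex (x1 - x0) 0) (2 * m) hy
  (cont_edgev hx cf).
set I1 := cint _ x0 x1 in H1; set I2 := cint _ y0 y1 in H2.
rewrite /rectint -/I1 -/I2.
have -> : I1 + 'i%C * I2 = (I1 - b * Complex 0 (y0 - y1) * (x1 - x0)%:C%C) +
   'i%C * (I2 - b * Complex (x1 - x0) 0 * (y1 - y0)%:C%C).
  rewrite mulrBr addrACA -[LHS]addr0; congr (_ + _).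
  rewrite -opprD -[LHS]oppr0; congr (- _).
  by case: b {near2 H1 H2 fm} => p q; apply/eqP; rewrite eq_complex /=;
    apply/andP; split; apply/eqP; ring.
apply: le_trans (normcD _ _) _; rewrite normcM normc_i mul1r.
have -> : 4 * m * (x1 - x0 + (y1 - y0)) = 2 * (2 * m) * (x1 - x0) +
  2 * (2 * m) * (y1 - y0) by ring.
apply: lerD.
  apply: H1 => x hx'.
  have -> : Complex 0 (y0 - y1) = Complex x y0 - Complex x y1.
    by apply/eqP; rewrite eq_complex /= subrr !eqxx.
  apply: near2; apply: rect_bdP => //; rewrite ?lexx ?hy//.
    by right; left.
  by right; right.
apply: H2 => y hy'.
have -> : Complex (x1 - x0) 0 = Complex x1 y - Complex x0 y.
  by apply/eqP; rewrite eq_complex /= subrr !eqxx.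
apply: near2; apply: rect_bdP => //; rewrite ?lexx ?hx//.
  by left; right.
by left; left.
Qed.

Lemma rectint_bound f x0 x1 y0 y1 (m : R) : x0 <= x1 -> y0 <= y1 ->
  cont_in f (rect_bd x0 x1 y0 y1) ->
  (forall z, rect_bd x0 x1 y0 y1 z -> normc (f z) <= m) ->
  normc (rectint f x0 x1 y0 y1) <= 4 * m * ((x1 - x0) + (y1 - y0)).
Proof.
move=> hx hy cf fm; apply: (@rectint_near f _ _ _ _ 0 0) => // z /fm.
by rewrite mul0r addr0 subr0.
Qed.

Lemma eq_rectint f g x0 x1 y0 y1 : x0 <= x1 -> y0 <= y1 ->
  (forall z, rect_bd x0 x1 y0 y1 z -> f z = g z) ->
  rectint f x0 x1 y0 y1 = rectint g x0 x1 y0 y1.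
Proof.
move=> hx hy fg; rewrite /rectint; congr (_ + _ * _); apply: eq_cint => t ht.
  by congr (_ - _); apply/fg/rect_bdP; rewrite ?lexx ?hy//; right; [left|right].
by congr (_ - _); apply/fg/rect_bdP; rewrite ?lexx ?hx//; left; [right|left].
Qed.

Lemma rectintD f g x0 x1 y0 y1 : x0 <= x1 -> y0 <= y1 ->
  cont_in f (rect_bd x0 x1 y0 y1) -> cont_in g (rect_bd x0 x1 y0 y1) ->
  rectint (fun z => f z + g z) x0 x1 y0 y1 =
  rectint f x0 x1 y0 y1 + rectint g x0 x1 y0 y1.
Proof.
move=> hx hy cf cg; rewrite /rectint.
have -> (h1 h2 h3 h4 : C) : h1 + 'i%C * h2 + (h3 + 'i%C * h4) =
  (h1 + h3) + 'i%C * (h2 + h4) by ring.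
rewrite -!cintD//; do ?[exact: cont_edgeh|exact: cont_edgev].
by congr (_ + _ * _); apply: eq_cint => t _; ring.
Qed.

Lemma rectintZ (k : C) f x0 x1 y0 y1 : x0 <= x1 -> y0 <= y1 ->
  cont_in f (rect_bd x0 x1 y0 y1) ->
  rectint (fun z => k * f z) x0 x1 y0 y1 = k * rectint f x0 x1 y0 y1.
Proof.
move=> hx hy cf; rewrite /rectint.
have -> (h1 h2 : C) : k * (h1 + 'i%C * h2) = k * h1 + 'i%C * (k * h2) by ring.
congr (_ + _ * _); rewrite -cintZ; do ?[exact: cont_edgeh|exact: cont_edgev].
  by apply: eq_cint => t _; rewrite mulrBr.
by apply: eq_cint => t _; rewrite mulrBr.
Qed.

Lemma nested_intervals (lo hi : nat -> R) :
  (forall n, lo n <= lo n.+1) -> (forall n, hi n.+1 <= hi n) ->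
  (forall n, lo n <= hi n) -> exists X, forall n, lo n <= X <= hi n.
Proof.
move=> up dn lh.
have upD n k : lo n <= lo (n + k)%N.
  by elim: k => [|k IH]; rewrite ?addn0// addnS (le_trans IH).
have dnD n k : hi (n + k)%N <= hi n.
  by elim: k => [|k IH]; rewrite ?addn0// addnS (le_trans _ IH).
have xx n m : lo n <= hi m.
  have [nm|/ltnW mn] := leqP n m.
    by rewrite -(subnKC nm) (le_trans (upD n (m - n)%N)).
  by rewrite -(subnKC mn) (le_trans _ (dnD m (n - m)%N)).
have hs : has_sup (range lo).
  by split; [exists (lo 0%N); exists 0%N | exists (hi 0%N) => _ [n _ <-]].
exists (sup (range lo)) => n; apply/andP; split.
  by apply: sup_upper_bound hs _ _; exists n.
by apply: ge_sup => [|_ [k _ <-]//]; exists (lo 0%N); exists 0%N.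
Qed.

Definition derivable_in f (A : set C) := forall z, A z -> derivable f z 1.

Lemma derivable_cont f (A B : set C) : A `<=` B -> derivable_in f B -> cont_in f A.
Proof. by move=> AB df z /AB /df /derivable_continuous. Qed.

Lemma sub_rect x0 x1 y0 y1 x0' x1' y0' y1' :
  x0 <= x0' -> x1' <= x1 -> y0 <= y0' -> y1' <= y1 ->
  rect x0' x1' y0' y1' `<=` rect x0 x1 y0 y1.
Proof.
move=> a b c d z [/andP[? ?] /andP[? ?]]; split; apply/andP; split; lra.
Qed.

Lemma rect_bd_rect x0 x1 y0 y1 : rect_bd x0 x1 y0 y1 `<=` rect x0 x1 y0 y1.
Proof. by move=> z []. Qed.

Lemma sub_rect_bd x0 x1 y0 y1 x0' x1' y0' y1' :
  x0 <= x0' -> x1' <= x1 -> y0 <= y0' -> y1' <= y1 ->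
  rect_bd x0' x1' y0' y1' `<=` rect x0 x1 y0 y1.
Proof. by move=> a b c d z /rect_bd_rect; exact: sub_rect. Qed.

Lemma rectint_quarters f x y (l k : R) : 0 <= l -> 0 <= k ->
  derivable_in f (rect x (x + l) y (y + k)) ->
  rectint f x (x + l) y (y + k) =
    rectint f x (x + l / 2) y (y + k / 2) +
    rectint f x (x + l / 2) (y + k / 2) (y + k / 2 + k / 2) +
    (rectint f (x + l / 2) (x + l / 2 + l / 2) y (y + k / 2) +
     rectint f (x + l / 2) (x + l / 2 + l / 2) (y + k / 2) (y + k / 2 + k / 2)).
Proof.
move=> l0 k0 df.
have El : x + l / 2 + l / 2 = x + l by lra.
have Ek : y + k / 2 + k / 2 = y + k by lra.
rewrite El Ek (@rectint_splitx f x (x + l / 2) (x + l)); last 5 first.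
- lra.
- lra.
- lra.
- apply: derivable_cont df; apply: sub_rect_bd; lra.
- apply: derivable_cont df; apply: sub_rect_bd; lra.
by congr (_ + _); apply: rectint_splity; try lra;
  apply: derivable_cont df; apply: sub_rect_bd; lra.
Qed.

(** The four contour integrals over the quarters add up to the integral over the
    rectangle, so they cannot all be smaller than a quarter of it. *)
Lemma rectint_bisect f x y (l k m : R) : 0 <= l -> 0 <= k ->
  derivable_in f (rect x (x + l) y (y + k)) ->
  m <= normc (rectint f x (x + l) y (y + k)) ->
  exists x' y', [/\ x <= x' /\ x' + l / 2 <= x + l,
    y <= y' /\ y' + k / 2 <= y + k &
    m / 4 <= normc (rectint f x' (x' + l / 2) y' (y' + k / 2))].
Proof.
move=> l0 k0 df; rewrite rectint_quarters// => {df}.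
have lo (t s : R) : 0 <= s -> t <= t /\ t + s / 2 <= t + s.
  by move=> s0; split; lra.
have hi (t s : R) : 0 <= s -> t <= t + s / 2 /\ t + s / 2 + s / 2 <= t + s.
  by move=> s0; split; lra.
have [xl xh yl yh] := And4 (lo x l l0) (hi x l l0) (lo y k k0) (hi y k k0).
set A1 := rectint f x (x + l / 2) y (y + k / 2).
set A2 := rectint f x (x + l / 2) (y + k / 2) _.
set A3 := rectint f (x + l / 2) _ y (y + k / 2).
set A4 := rectint f (x + l / 2) _ (y + k / 2) _ => mA.
have [E1|E1] := leP (m / 4) (normc A1); first by exists x, y.
have [E2|E2] := leP (m / 4) (normc A2); first by exists x, (y + k / 2).
have [E3|E3] := leP (m / 4) (normc A3); first by exists (x + l / 2), y.
have [E4|E4] := leP (m / 4) (normc A4); first by exists (x + l / 2), (y + k / 2).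
have := normcD (A1 + A2) (A3 + A4); have := normcD A1 A2; have := normcD A3 A4.
move: mA E1 E2 E3 E4; clear; lra.
Qed.

(** Cauchy's theorem for a rectangle.  If the integral is not zero, bisection
    selects nested rectangles whose integrals decrease at most like their
    areas; at the common point differentiability makes them decrease faster. *)
Lemma goursat f x0 x1 y0 y1 : x0 <= x1 -> y0 <= y1 ->
  derivable_in f (rect x0 x1 y0 y1) -> rectint f x0 x1 y0 y1 = 0.
Proof.
move=> hx hy df.
pose L := x1 - x0; pose H := y1 - y0; pose h n : R := 2^-1 ^+ n.
have L0 : 0 <= L by rewrite subr_ge0.
have H0 : 0 <= H by rewrite subr_ge0.
have h0 n : 0 < h n by rewrite exprn_gt0// invr_gt0.
have hS n : h n.+1 = h n / 2 by rewrite /h exprS mulrC.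
have Lh n : 0 <= L * h n by rewrite mulr_ge0// ltW.
have Hh n : 0 <= H * h n by rewrite mulr_ge0// ltW.
pose K := normc (rectint f x0 x1 y0 y1).
(* [s] is the lower left corner of the rectangle reached after [n] bisections *)
pose P n (s : R * R) := [/\ x0 <= s.1, s.1 + L * h n <= x1, y0 <= s.2,
  s.2 + H * h n <= y1 &
  K * h n ^+ 2 <= normc (rectint f s.1 (s.1 + L * h n) s.2 (s.2 + H * h n))].
pose Q n (s s' : R * R) :=
  (s.1 <= s'.1 /\ s'.1 + L * h n.+1 <= s.1 + L * h n) /\
  (s.2 <= s'.2 /\ s'.2 + H * h n.+1 <= s.2 + H * h n).
have step n s : exists s', P n s -> P n.+1 s' /\ Q n s s'.
  have [Ps|nP] := pselect (P n s); last by exists s.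
  have [a b c d e] := Ps.
  have LS : L * h n.+1 = L * h n / 2 by rewrite hS mulrA.
  have HS : H * h n.+1 = H * h n / 2 by rewrite hS mulrA.
  have KS : K * h n.+1 ^+ 2 = K * h n ^+ 2 / 4 by rewrite hS; field.
  rewrite /P /Q LS HS KS.
  have [|x' [y' [[xx' x'x] [yy' y'y] m']]] := rectint_bisect (Lh n) (Hh n) _ e.
    by move=> z zr; apply: df; apply: sub_rect zr.
  by exists (x', y') => _; split; [split => //=|split];
    do ?[exact: le_trans a xx'|exact: le_trans c yy'|exact: le_trans x'x b
        |exact: le_trans y'y d].
have [F HF] : exists F : nat -> R * R -> R * R,
    forall n s, P n s -> P n.+1 (F n s) /\ Q n s (F n s).
  have /choice[F HF] : forall ns : nat * (R * R),
      exists s', P ns.1 ns.2 -> P ns.1.+1 s' /\ Q ns.1 ns.2 s'.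
    by move=> [n s]; exact: step.
  by exists (fun n s => F (n, s)) => n s; exact: (HF (n, s)).
pose s := fix s n := if n is m.+1 then F m (s m) else (x0, y0).
have Ps n : P n (s n).
  elim: n => [|n IH]; last by have [] := HF _ _ IH.
  rewrite /P /h expr0 /= !mulr1 /L /H !subrKC expr1n mulr1; split=> //.
have Qs n : Q n (s n) (s n.+1) by have [] := HF _ _ (Ps n).
have [X HX] : exists X, forall n, (s n).1 <= X <= (s n).1 + L * h n.
  apply: (@nested_intervals (fun n => (s n).1)) => n; last by rewrite lerDl.
  - by have [[]] := Qs n.
  - by have [[]] := Qs n.
have [Y HY] : exists Y, forall n, (s n).2 <= Y <= (s n).2 + H * h n.
  apply: (@nested_intervals (fun n => (s n).2)) => n; last by rewrite lerDl.
  - by have [_ []] := Qs n.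
  - by have [_ []] := Qs n.
pose z0 : C := Complex X Y.
have rz0 : rect x0 x1 y0 y1 z0.
  have [a b c d _] := Ps 0%N; have /andP[? ?] := HX 0%N; have /andP[? ?] := HY 0%N.
  by split => /=; apply/andP; split; lra.
have /cdiffP[d cd] := df _ rz0.
suff K0 : K <= 0.
  by apply/eqP; rewrite -normc_eq0 eq_le normc_ge0 andbT.
apply: (@ler_addsmall _ K 0 (4 * (L + H) ^+ 2)) => e e0 _; rewrite add0r.
have [a a0 Ha] := cd e e0.
have [n Hn] : exists n, (L + H) * h n < a.
  have : (fun n => (L + H) * h n) @ \oo --> (L + H) * 0.
    by apply: cvgM; [exact: cvg_cst|apply: cvg_expr; rewrite ger0_norm; lra].
  rewrite mulr0 => /cvgrPdist_lt /(_ a a0)[N _ HN]; exists N.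
  have := HN N (leqnn N) => /=; rewrite sub0r normrN; exact: le_lt_trans (ler_norm _).
have [p1 p2 p3 p4 p5] := Ps n.
have zn z : rect (s n).1 ((s n).1 + L * h n) (s n).2 ((s n).2 + H * h n) z ->
    normc (z - z0) <= (L + H) * h n.
  move=> [/andP[? ?] /andP[? ?]]; have /andP[? ?] := HX n; have /andP[? ?] := HY n.
  apply: le_trans (normc_le_ReIm _) _; rewrite mulrDl !raddfB /=.
  apply: lerD; rewrite ler_norml; apply/andP; split;
    by rewrite ?lerBrDl ?lerBlDl ?lerBrDr; lra.
(* compare [f] with its first order expansion at [z0] on the n-th rectangle *)
rewrite -(ler_pM2r (exprn_gt0 2 (h0 n))).
apply: (le_trans p5).
have -> : 4 * (L + H) ^+ 2 * e * h n ^+ 2 =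
  4 * (e * ((L + H) * h n)) * ((((s n).1 + L * h n) - (s n).1) +
     (((s n).2 + H * h n) - (s n).2)) by ring.
apply: (@rectint_near f _ _ _ _ (f z0 - z0 * d) d); rewrite ?lerDl//.
  by apply: derivable_cont df; exact: sub_rect_bd.
move=> z /rect_bd_rect/zn hz.
have -> : f z - (f z0 - z0 * d + d * z) = f (z0 + (z - z0)) - f z0 - (z - z0) * d.
  by rewrite subrKC; ring.
apply: le_trans (Ha _ (le_lt_trans hz Hn)) _.
by rewrite ler_wpM2l// ltW.
Qed.

End Rectangles.

(** * Cauchy's formula on squares and Taylor expansions *)

Section CauchyFormula.
Context {R : realType}.
Local Notation C := (Cplx R).
Local Notation Re := (@complex.Re R).
Local Notation Im := (@complex.Im R).
Implicit Types (f g : C -> C) (z w q : C) (a x y : R).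

Lemma derivable_mul f g z : derivable f z 1 -> derivable g z 1 ->
  derivable (fun z => f z * g z) z 1.
Proof. by move=> df dg; exact: (derivableM df dg). Qed.

Lemma derivable_sub f g z : derivable f z 1 -> derivable g z 1 ->
  derivable (fun z => f z - g z) z 1.
Proof. by move=> df dg; exact: (derivableB df dg). Qed.

Lemma derivable_invB w z : z != w -> derivable (fun z : C => (z - w)^-1 : C) z 1.
Proof.
move=> zw; apply: (@derivableV _ _ (fun z : C => z - w)).
  by rewrite subr_eq0.
by apply: derivableB; [exact: derivable_id|exact: derivable_cst].
Qed.

Lemma derivable_inv z : z != 0 -> derivable (fun z : C => z^-1 : C) z 1.
Proof. by move=> z0; apply: derivableV z0 _; exact: derivable_id. Qed.

Lemma derivable_invX z n : z != 0 -> derivable (fun z : C => z^-1 ^+ n : C) z 1.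
Proof.
move=> z0; elim: n => [|n IH].
  under eq_fun do rewrite expr0; exact: derivable_cst.
under eq_fun do rewrite exprS.
by apply: derivable_mul IH; exact: derivable_inv.
Qed.

Lemma derivable_shift f q z : derivable f (q + z) 1 ->
  derivable (fun z => f (q + z)) z 1.
Proof.
move=> /cdiffP[d cd]; apply/cdiffP; exists d => e /cd[r r0 Hr]; exists r => // h.
by rewrite addrA; exact: Hr.
Qed.

(** The frame between two nested rectangles is cut into four rectangles, on each
    of which Goursat's lemma applies; [f] may be singular in the inner one. *)
Lemma rectint_frame f x0 x1 x2 x3 y0 y1 y2 y3 :
  x0 <= x1 -> x1 <= x2 -> x2 <= x3 -> y0 <= y1 -> y1 <= y2 -> y2 <= y3 ->
  derivable_in f [set z | rect x0 x3 y0 y3 z /\ ~ (x1 < Re z < x2 /\ y1 < Im z < y2)] ->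
  rectint f x0 x3 y0 y3 = rectint f x1 x2 y1 y2.
Proof.
move=> x01 x12 x23 y01 y12 y23; set D := [set _ | _] => df.
have y03 : y0 <= y3 by apply: le_trans y01 (le_trans y12 y23).
have x13 : x1 <= x3 by apply: le_trans x12 x23.
have y13 : y1 <= y3 by apply: le_trans y12 y23.
have x03 : x0 <= x3 by apply: le_trans x01 x13.
have subL : rect x0 x1 y0 y3 `<=` D.
  move=> z [/andP[a b] cd]; split; first by split; rewrite ?a ?(le_trans b).
  by move=> [/andP[c _] _]; move: (lt_le_trans c b); rewrite ltxx.
have subR : rect x2 x3 y0 y3 `<=` D.
  move=> z [/andP[a b] cd]; split; first by split; rewrite ?b ?(le_trans _ a) ?(le_trans x01).
  by move=> [/andP[_ c] _]; move: (lt_le_trans c a); rewrite ltxx.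
have subB : rect x1 x2 y0 y1 `<=` D.
  move=> z [/andP[a b] /andP[c d]]; split.
    by split; rewrite ?c ?(le_trans _ a) ?(le_trans b) ?(le_trans d).
  by move=> [_ /andP[e _]]; move: (lt_le_trans e d); rewrite ltxx.
have subT : rect x1 x2 y2 y3 `<=` D.
  move=> z [/andP[a b] /andP[c d]]; split.
    by split; rewrite ?d ?(le_trans _ a) ?(le_trans b) ?(le_trans _ c) ?(le_trans y01).
  by move=> [_ /andP[_ e]]; move: (lt_le_trans e c); rewrite ltxx.
have subM (u0 u1 v0 v1 : R) : x0 <= u0 -> u0 <= x1 -> x2 <= u1 -> u1 <= x3 ->
    y0 <= v0 -> v0 <= y1 -> y2 <= v1 -> v1 <= y3 -> rect_bd u0 u1 v0 v1 `<=` D.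
  move=> p1 p2 p3 p4 p5 p6 p7 p8 z [[/andP[a b] /andP[c d]] nz]; split.
    by split; rewrite ?(le_trans _ a) ?(le_trans b) ?(le_trans _ c) ?(le_trans d).
  move=> [/andP[a' b'] /andP[c' d']]; apply: nz; split; apply/andP; split.
  - exact: le_lt_trans a'.
  - exact: lt_le_trans p3.
  - exact: le_lt_trans c'.
  - exact: lt_le_trans p7.
have bdc u0 u1 v0 v1 : rect u0 u1 v0 v1 `<=` D -> cont_in f (rect_bd u0 u1 v0 v1).
  by move=> s; apply: derivable_cont df; apply: subset_trans s; exact: rect_bd_rect.
have zero u0 u1 v0 v1 : u0 <= u1 -> v0 <= v1 -> rect u0 u1 v0 v1 `<=` D ->
    rectint f u0 u1 v0 v1 = 0.
  by move=> hu hv s; apply: goursat => // z /s; exact: df.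
rewrite (@rectint_splitx _ f x0 x1)//; [|exact: bdc|]; last first.
  by apply: derivable_cont df; exact: subM.
rewrite (zero x0 x1)// add0r (@rectint_splitx _ f x1 x2)//; [|
  by apply: derivable_cont df; exact: subM|exact: bdc].
rewrite (zero x2 x3)// addr0 (@rectint_splity _ f _ _ y0 y1)//; [|exact: bdc|]; last first.
  by apply: derivable_cont df; exact: subM.
rewrite (zero _ _ y0 y1)// add0r (@rectint_splity _ f _ _ y1 y2)//; [|
  by apply: derivable_cont df; exact: subM|exact: bdc].
by rewrite (zero _ _ y2 y3)// addr0.
Qed.

Definition sqint f a := rectint f (- a) a (- a) a.
Local Notation sq a := (rect (- a) a (- a) a).
Local Notation sq_bd a := (rect_bd (- a) a (- a) a).

Lemma sq_bd_ge a z : sq_bd a z -> a <= normc z.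
Proof.
move=> [[/andP[a1 a2] /andP[a3 a4]] nz]; rewrite leNgt; apply/negP => za.
apply: nz; have := le_lt_trans (Re_le_normc z) za.
by have := le_lt_trans (Im_le_normc z) za; rewrite !ltr_norml.
Qed.

Lemma sq_le a z : sq a z -> normc z <= 2 * a.
Proof.
move=> [ha hb]; apply: le_trans (normc_le_ReIm z) _.
by rewrite mulr_natl mulr2n lerD// ler_norml.
Qed.

Lemma normc_lt_neq a w z : normc w < a -> a <= normc z -> z != w.
Proof. by move=> wa az; apply: contraTneq az => ->; rewrite -ltNge. Qed.

Lemma sqint_bound f a m : 0 <= a -> cont_in f (sq_bd a) ->
  (forall z, sq_bd a z -> normc (f z) <= m) -> normc (sqint f a) <= 16 * a * m.
Proof.
move=> a0 cf fm; have a0' : - a <= a by lra.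
apply: le_trans (rectint_bound a0' a0' cf fm) _; lra.
Qed.

Lemma eq_sqint f g a : 0 <= a -> (forall z, sq_bd a z -> f z = g z) ->
  sqint f a = sqint g a.
Proof. by move=> a0 fg; apply: eq_rectint => //; lra. Qed.

Lemma sqintD f g a : 0 <= a -> cont_in f (sq_bd a) -> cont_in g (sq_bd a) ->
  sqint (fun z => f z + g z) a = sqint f a + sqint g a.
Proof. by move=> a0 cf cg; apply: rectintD => //; lra. Qed.

Lemma sqintZ (k : C) f a : 0 <= a -> cont_in f (sq_bd a) ->
  sqint (fun z => k * f z) a = k * sqint f a.
Proof. by move=> a0 cf; apply: rectintZ => //; lra. Qed.

Lemma derivable_sq_cont f a : (forall z, sq_bd a z -> derivable f z 1) ->
  cont_in f (sq_bd a).
Proof. by move=> df z /df/derivable_continuous. Qed.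

(** The value is [2 pi i]; only its independence of the pole and a lower bound
    for its modulus matter. *)
Definition kappa a := sqint (fun z => z^-1) a.

(** Parametrized by the real coordinate, the integrand is
    [2 a / (a ^ 2 + y ^ 2)] up to the factor [i], once for the horizontal and once
    for the vertical edges.  It lies within [1 / (2 a)] of [3 / (2 a)] on an
    interval of length [2 a]. *)
Lemma kappa_ge2 a : 0 < a -> 2 <= normc (kappa a).
Proof.
move=> a0; have a0' : - a <= a by lra.
rewrite /kappa /sqint /rectint.
set v := (X in _ + _ * cint X _ _); set u := (X in cint X _ _ + _).
have cv : continuous_on v (- a) a.
  apply: cont_edgev => //; apply: derivable_sq_cont => z /sq_bd_ge az.
  by apply/derivable_inv/normc_lt_neq/az; rewrite ComplexField.Normc.normc0.
have vE y : v y = (2 * a / (a ^+ 2 + y ^+ 2))%:C%C.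
  rewrite /v; apply/eqP; rewrite eq_complex /= sqrrN; apply/andP; split; apply/eqP.
    by ring.
  by ring.
have -> : cint u (- a) a = 'i%C * cint v (- a) a.
  rewrite -cintZ//; apply: eq_cint => x _; rewrite vE /u.
  apply/eqP; rewrite eq_complex /= sqrrN; apply/andP; split; apply/eqP; last first.
    by rewrite mul0r mul1r add0r [x ^+ 2 + _]addrC; ring.
  by rewrite !mul0r mul1r subr0 subrr.
rewrite -mulr2n -[X in normc X]mulr_natl !normcM normc_i mul1r.
have -> : normc (2%:R : C) = 2 by rewrite -[2%:R](rmorph_nat (real_complex R)) normc_real ger0_norm.
suff H : 1 <= normc (cint v (- a) a) by lra.
have := @cint_near _ v (- a) a (3 / (2 * a))%:C%C (1 / (2 * a)) a0' cv.
have -> : 2 * (1 / (2 * a)) * (a - - a) = 2 by field; rewrite gt_eqF.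
have -> : (3 / (2 * a))%:C%C * (a - - a)%:C%C = 3%:C%C :> C.
  by rewrite -rmorphM /=; congr (_%:C)%C; field; rewrite gt_eqF.
move=> H; have {}H : normc (cint v (- a) a - (3%:C%C : C)) <= 2.
  apply: H => y /andP[y1 y2]; rewrite vE -rmorphB normc_real.
  have yy : y ^+ 2 <= a ^+ 2 by rewrite -ler_sqrt ?sqr_ge0// !sqrtr_sqr (gtr0_norm a0) ler_norml y1.
  have s0 : 0 < a ^+ 2 + y ^+ 2 by rewrite ltr_wpDr ?sqr_ge0// exprn_gt0.
  have i1 : 1 / a <= 2 * a / (a ^+ 2 + y ^+ 2).
    by rewrite ler_pdivlMr// mulrC mulrA mulr1 ler_pdivrMr//; lra.
  have i2 : 2 * a / (a ^+ 2 + y ^+ 2) <= 2 / a.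
    by rewrite ler_pdivrMr// mulrAC ler_pdivlMr//; have := sqr_ge0 y; lra.
  have e1 : 3 / (2 * a) = 1 / a + 1 / a / 2 by field; rewrite gt_eqF.
  have e2 : 1 / (2 * a) = 1 / a / 2 by field; rewrite gt_eqF.
  have e3 : 2 / a = 1 / a + 1 / a by field; rewrite gt_eqF.
  by rewrite ler_norml e1 e2; rewrite e3 in i2; apply/andP; split; lra.
have := normcBB (3%:C%C : C) (cint v (- a) a); rewrite normcBC normc_real ger0_norm; lra.
Qed.

Lemma kappa_neq0 a : 0 < a -> kappa a != 0.
Proof. by move/kappa_ge2 => k2; rewrite -normc_gt0; lra. Qed.

(** The integrand [1 / (z - w) - 1 / z] decays quadratically, hence its integral
    is seen to vanish on enlarging the square. *)
Lemma kappa_pole a w : normc w < a -> sqint (fun z => (z - w)^-1) a = kappa a.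
Proof.
move=> wa; have a0 : 0 < a by apply: le_lt_trans (normc_ge0 w) wa.
pose g z : C := (z - w)^-1 - z^-1.
have dg z : a <= normc z -> derivable g z 1.
  move=> az; apply: derivable_sub.
    by apply: derivable_invB; exact: normc_lt_neq az.
  by apply: derivable_inv; apply: normc_lt_neq az; rewrite ComplexField.Normc.normc0.
have cd z : sq_bd a z -> derivable g z 1 by move=> /sq_bd_ge/dg.
rewrite (@eq_sqint _ (fun z => g z + z^-1) _ (ltW a0)); last by move=> z _; rewrite /g subrK.
have ci : cont_in (fun z : C => z^-1 : C) (sq_bd a).
  apply: derivable_sq_cont => z /sq_bd_ge az.
  by apply/derivable_inv/normc_lt_neq/az; rewrite ComplexField.Normc.normc0.
rewrite (sqintD (ltW a0) (derivable_sq_cont cd) ci).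
rewrite -/(kappa a) -[RHS]add0r; congr (_ + _).
suff K0 : normc (sqint g a) <= 0 by apply/eqP; rewrite -normc_eq0 eq_le normc_ge0 andbT.
apply: (@ler_addsmall _ _ 0 1) => e e0 _; rewrite add0r mul1r.
(* the side for which the bound [16 A * (a / (A (A - a)))] equals [e] *)
pose A := a + 16 * a / e.
have A0 : a < A by rewrite ltrDl divr_gt0// mulr_gt0.
have -> : sqint g a = sqint g A.
  rewrite /sqint [RHS](@rectint_frame _ _ (- a) a _ _ (- a) a)//; try lra.
  move=> z [_ nz]; apply: dg; rewrite leNgt; apply/negP => za; apply: nz.
  have := le_lt_trans (Re_le_normc z) za.
  by have := le_lt_trans (Im_le_normc z) za; rewrite !ltr_norml.
have Aa : 0 < A - a by rewrite subr_gt0.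
have Agt0 : 0 < A by apply: lt_trans A0.
have -> : e = 16 * A * (a / (A * (A - a))).
  by rewrite /A; field; rewrite !gt_eqF//= ?mulr_gt0//; rewrite -/A; nra.
apply: sqint_bound; first exact: ltW.
  by apply: derivable_sq_cont => z /sq_bd_ge Az; apply: dg; apply: le_trans Az; exact: ltW.
move=> z /sq_bd_ge Az.
have zw : z - w != 0 by rewrite subr_eq0; apply: normc_lt_neq Az; exact: lt_trans A0.
have z0 : z != 0 by apply: normc_lt_neq Az; rewrite ComplexField.Normc.normc0.
have zwA : A - a <= normc (z - w).
  by apply: le_trans (normcBB z w); apply: lerB => //; exact: ltW.
have -> : g z = w / (z * (z - w)) by rewrite /g; field; rewrite ?zw ?z0.
rewrite normcM normcV normcM ler_pM ?normc_ge0 ?invr_ge0 ?mulr_ge0 ?normc_ge0 ?(ltW wa)//.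
rewrite lef_pV2 ?posrE ?mulr_gt0 ?normc_gt0//.
by apply: ler_pM; rewrite ?(ltW Agt0) ?(ltW Aa).
Qed.

(** Near the removable singularity [w] the difference quotient is bounded, so
    that its integral over small squares around [w] tends to zero. *)
Lemma sqint_diffquot f a w : normc w < a -> derivable_in f (sq a) ->
  sqint (fun z => (f z - f w) / (z - w)) a = 0.
Proof.
move=> wa df; have a0 : 0 < a by apply: le_lt_trans (normc_ge0 w) wa.
pose g z : C := (f z - f w) / (z - w).
have inw z : normc z <= a -> sq a z.
  move=> za; have := le_trans (Re_le_normc z) za.
  by have := le_trans (Im_le_normc z) za; rewrite !ler_norml; split.
have dg z : sq a z -> z != w -> derivable g z 1.
  move=> /df dz zw; apply: derivable_mul; last exact: derivable_invB.
  by apply: (derivable_sub dz); exact: derivable_cst.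
have /cdiffP[d cd] := df w (inw w (ltW wa)).
have [r r0 Hr] := cd 1 ltr01.
suff K0 : normc (sqint g a) <= 0 by apply/eqP; rewrite -normc_eq0 eq_le normc_ge0 andbT.
(* squares of half-side [t < t0] around [w] stay in the large square and in the
   disc where the difference quotient is bounded by [normc d + 1] *)
pose t0 := Num.min (r / 2) (a - normc w).
have t00 : 0 < t0 by rewrite lt_min divr_gt0// subr_gt0.
apply: (@ler_addsmall _ _ 0 (16 * t0 * (normc d + 1))) => e e0 e1; rewrite add0r.
pose t := t0 * e; have tt : 0 < t by rewrite mulr_gt0.
have tt0 : t < t0 by rewrite /t gtr_pMr.
have tr : 2 * t < r by move: tt0; rewrite lt_min => /andP[? _]; lra.
have ta : t < a - normc w by move: tt0; rewrite lt_min => /andP[].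
have /andP[re1 re2] : - (normc w) <= Re w <= normc w by rewrite -ler_norml Re_le_normc.
have /andP[im1 im2] : - (normc w) <= Im w <= normc w by rewrite -ler_norml Im_le_normc.
rewrite /sqint (@rectint_frame _ _ (Re w - t) (Re w + t) _ (- a) (Im w - t) (Im w + t)); last 7 first.
- by clear -ta re1; lra.
- by clear -tt; lra.
- by clear -ta re2; lra.
- by clear -ta im1; lra.
- by clear -tt; lra.
- by clear -ta im2; lra.
- move=> z [sz nz]; apply: dg => //; apply/eqP => zw; apply: nz; rewrite zw.
  by rewrite !ltrDl !ltrBlDr !ltrDl tt.
have bd z : rect_bd (Re w - t) (Re w + t) (Im w - t) (Im w + t) z ->
    [/\ sq a z, z != w & normc (z - w) < r].
  move=> [[/andP[b1 b2] /andP[b3 b4]] nz]; split.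
  - by split; apply/andP; split; clear -b1 b2 b3 b4 ta re1 re2 im1 im2; lra.
  - by apply/eqP => zw; apply: nz; rewrite zw !ltrDl !ltrBlDr !ltrDl tt.
  - apply: le_lt_trans tr; apply: le_trans (normc_le_ReIm _) _.
    rewrite mulr_natl mulr2n !raddfB /=.
    have near1 (u v : R) : v - t <= u -> u <= v + t -> `|u - v| <= t.
      by clear => h1 h2; rewrite ler_norml; apply/andP; split; lra.
    by apply: lerD; apply: near1.
have -> : 16 * t0 * (normc d + 1) * e = 4 * (normc d + 1) *
    ((Re w + t - (Re w - t)) + (Im w + t - (Im w - t))) by rewrite /t; ring.
apply: rectint_bound.
- by clear -tt; lra.
- by clear -tt; lra.
- by move=> z /bd[? ? _]; apply/derivable_continuous/dg.
move=> z /bd[_ zw zr]; have := Hr _ zr; rewrite subrKC mul1r => H.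
have h0 : 0 < normc (z - w) by rewrite normc_gt0 subr_eq0.
rewrite /g normcM normcV ler_pdivrMr//.
have := normcBB (f z - f w) ((z - w) * d); rewrite normcM; lra.
Qed.

Lemma cauchy_formula f a w : normc w < a -> derivable_in f (sq a) ->
  sqint (fun z => f z * (z - w)^-1) a = f w * kappa a.
Proof.
move=> wa df; have a0 : 0 < a by apply: le_lt_trans (normc_ge0 w) wa.
have bdw z : sq_bd a z -> z != w by move=> /sq_bd_ge; exact: normc_lt_neq.
have dw z : sq_bd a z -> derivable (fun z : C => (z - w)^-1 : C) z 1.
  by move=> /bdw; exact: derivable_invB.
rewrite (@eq_sqint _ (fun z => (f z - f w) / (z - w) + f w * (z - w)^-1) _ (ltW a0));
  last by move=> z _; rewrite -mulrDl subrK.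
rewrite (sqintD (ltW a0)); last 2 first.
- apply: derivable_sq_cont => z zb; apply: derivable_mul; last exact: dw.
  by apply: derivable_sub; [apply/df/rect_bd_rect|exact: derivable_cst].
- apply: derivable_sq_cont => z zb; apply: derivable_mul; last exact: dw.
  exact: derivable_cst.
rewrite (sqint_diffquot wa df) add0r (sqintZ _ (ltW a0) (derivable_sq_cont dw)).
by rewrite (kappa_pole wa).
Qed.

(** Taylor expansion with Cauchy's estimates.  The square of half-side [a]
    around 0 lies in the disc of radius [2 a] and contains the disc of
    radius [a], so that [normc w < normc z] on the contour and
    [1 / (z - w)] expands into a geometric series in [w / z]. *)
Lemma taylor0 f a M : 0 < a ->
  derivable_in f (sq a) -> (forall z, sq a z -> normc (f z) <= M) ->
  exists c : nat -> C, (forall k, normc (c k) * a ^+ k <= 8 * M) /\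
    forall n w, normc w < a -> normc (f w - \sum_(k < n) c k * w ^+ k) <=
      8 * a * M / (a - normc w) * (normc w / a) ^+ n.
Proof.
move=> a0 df fM; have a0' := ltW a0.
pose b k := sqint (fun z => f z * z^-1 ^+ k.+1) a.
have K2 := kappa_ge2 a0; have K0 := kappa_neq0 a0.
have bd0 z : sq_bd a z -> z != 0.
  by move=> /sq_bd_ge; apply: normc_lt_neq; rewrite ComplexField.Normc.normc0.
have dk k z : sq_bd a z -> derivable (fun z => f z * z^-1 ^+ k) z 1.
  move=> zb; apply: derivable_mul; first by apply/df/rect_bd_rect.
  by apply/derivable_invX/bd0.
have M0 : 0 <= M.
  apply: le_trans (normc_ge0 (f 0)) (fM 0 _).
  by split => /=; rewrite a0' oppr_le0 a0'.
have invK : (normc (kappa a))^-1 <= 2^-1 by rewrite lef_pV2 ?posrE//; lra.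
exists (fun k => (kappa a)^-1 * b k); split=> [k|n w wa].
  rewrite normcM normcV.
  have bk : normc (b k) <= 16 * a * (M * (a ^+ k.+1)^-1).
    apply: sqint_bound => //; first by apply: derivable_sq_cont => z /dk.
    move=> z zb; have az := sq_bd_ge zb.
    rewrite normcM normcX normcV -exprVn ler_pM ?normc_ge0 ?exprn_ge0 ?invr_ge0 ?normc_ge0//.
      by apply/fM/rect_bd_rect.
    by rewrite lerXn2r ?nnegrE ?invr_ge0 ?normc_ge0// lef_pV2 ?posrE//; apply: lt_le_trans az.
  have -> : 8 * M = 2^-1 * (16 * a * (M * (a ^+ k.+1)^-1)) * a ^+ k.
    by rewrite exprS; field; rewrite expf_neq0 gt_eqF.
  rewrite ler_wpM2r ?exprn_ge0// ler_pM ?invr_ge0 ?normc_ge0//.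
have zw z : sq_bd a z -> z != w by move=> /sq_bd_ge; exact: normc_lt_neq.
pose r m := sqint (fun z => f z * z^-1 ^+ m * (z - w)^-1) a.
have dr m z : sq_bd a z -> derivable (fun z => f z * z^-1 ^+ m * (z - w)^-1) z 1.
  by move=> zb; apply: derivable_mul; [exact: dk|apply/derivable_invB/zw].
have E m : f w * kappa a = \sum_(k < m) w ^+ k * b k + w ^+ m * r m.
  elim: m => [|m IH].
    rewrite big_ord0 add0r expr0 mul1r -(cauchy_formula wa df).
    by apply: eq_sqint => // z _; rewrite expr0 mulr1.
  rewrite IH big_ord_recr /= -addrA; congr (_ + _).
  rewrite exprSr -mulrA -mulrDr; congr (_ * _).
  rewrite /b /r -(sqintZ _ a0'); last by apply: derivable_sq_cont => z /dr.
  rewrite -(sqintD a0').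
  - apply: eq_sqint => // z zb; have z0 := bd0 z zb; have zw0 := zw z zb.
    by rewrite exprSr; field; rewrite subr_eq0 zw0 z0.
  - by apply: derivable_sq_cont => z /dk.
  - apply: derivable_sq_cont => z /(dr m.+1) dz.
    by apply: (@derivable_mul (fun=> w) _ _ _ dz); exact: derivable_cst.
have -> : f w - \sum_(k < n) (kappa a)^-1 * b k * w ^+ k = (kappa a)^-1 * (w ^+ n * r n).
  have -> : w ^+ n * r n = f w * kappa a - \sum_(k < n) w ^+ k * b k.
    by rewrite (E n) addrC addKr.
  rewrite mulrBr mulrCA mulVf// mulr1 mulr_sumr; congr (_ - _).
  by apply: eq_bigr => k _; rewrite mulrCA mulrC mulrA.
have wa0 : 0 < a - normc w by rewrite subr_gt0.
have rn : normc (r n) <= 16 * a * (M * (a ^+ n)^-1 * (a - normc w)^-1).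
  apply: sqint_bound => //; first by apply: derivable_sq_cont => z /dr.
  move=> z zb; have az := sq_bd_ge zb.
  rewrite !normcM !normcX !normcV -exprVn.
  have aw : a - normc w <= normc (z - w) by apply: le_trans (normcBB z w); lra.
  apply: ler_pM; rewrite ?mulr_ge0 ?exprn_ge0 ?invr_ge0 ?normc_ge0//.
    apply: ler_pM; rewrite ?exprn_ge0 ?invr_ge0 ?normc_ge0//.
      by apply/fM/rect_bd_rect.
    rewrite lerXn2r ?nnegrE ?invr_ge0 ?normc_ge0//.
    by rewrite lef_pV2 ?posrE//; apply: lt_le_trans az.
  by rewrite lef_pV2 ?posrE//; apply: lt_le_trans aw.
rewrite normcM normcV normcM normcX.
have -> : 8 * a * M / (a - normc w) * (normc w / a) ^+ n =
  2^-1 * (normc w ^+ n * (16 * a * (M * (a ^+ n)^-1 * (a - normc w)^-1))).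
  by rewrite expr_div_n; field; rewrite expf_neq0 ?gt_eqF.
by rewrite ler_pM ?mulr_ge0 ?invr_ge0 ?exprn_ge0 ?normc_ge0// ler_wpM2l ?exprn_ge0 ?normc_ge0.
Qed.

Lemma taylor f q a M : 0 < a ->
  (forall z, normc (z - q) <= 2 * a -> derivable f z 1 /\ normc (f z) <= M) ->
  exists c : nat -> C, (forall k, normc (c k) * a ^+ k <= 8 * M) /\
    forall n w, normc w < a -> normc (f (q + w) - \sum_(k < n) c k * w ^+ k) <=
      8 * a * M / (a - normc w) * (normc w / a) ^+ n.
Proof.
move=> a0 H; have H' z : sq a z -> derivable f (q + z) 1 /\ normc (f (q + z)) <= M.
  by move=> /sq_le za; apply: H; rewrite [q + z]addrC addrK.
exact: (@taylor0 (fun z => f (q + z)) a M a0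
  (fun z zs => derivable_shift (H' z zs).1) (fun z zs => (H' z zs).2)).
Qed.

End CauchyFormula.

(** * Taylor coefficients and the identity theorem *)

Section AsymptoticExpansion.
Context {R : realType}.
Local Notation C := (Cplx R).
Implicit Types (f g h : C -> C) (z w q : C) (c : nat -> C).

(** Taylor coefficients of [f] at [q] without derivatives of higher order: this
    relation depends only on the germ of [f] and determines [c]. *)
Definition aexp f q c := forall n, exists K, exists2 r : R, 0 < r &
  forall w, normc w < r ->
    normc (f (q + w) - \sum_(k < n) c k * w ^+ k) <= K * normc w ^+ n.

Lemma aexp_unique f q c c' : aexp f q c -> aexp f q c' -> forall k, c k = c' k.
Proof.
move=> fc fc' k.
suff H m j : (j < m)%N -> c j = c' j by exact: (H k.+1).
elim: m j => // m IH j; rewrite ltnS leq_eqVlt => /predU1P[->{j}|]; last exact: IH.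
have [K [r r0 HK]] := fc m.+1; have [K' [r' r'0 HK']] := fc' m.+1.
apply/eqP; rewrite -subr_eq0 -normc_eq0 eq_le normc_ge0 andbT.
pose t0 := Num.min r r'; have t00 : 0 < t0 by rewrite lt_min r0.
apply: (@ler_addsmall _ _ 0 ((K + K') * t0)) => e e0 e1; rewrite add0r.
pose t := t0 * e; have tt : 0 < t by rewrite mulr_gt0.
have nt : normc (t%:C%C : C) = t by rewrite normc_real gtr0_norm.
have tt0 : t < t0 by rewrite /t gtr_pMr.
have [tr tr'] : t < r /\ t < r' by apply/andP; rewrite -lt_min.
have H1 := HK t%:C%C; have H2 := HK' t%:C%C; rewrite !nt in H1 H2.
rewrite -mulrA -/t -(ler_pM2r (exprn_gt0 m tt)) -{1}nt -normcX -normcM.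
rewrite !big_ord_recr /= in H1 H2.
have S : \sum_(i < m) c i * t%:C%C ^+ i = \sum_(i < m) c' i * t%:C%C ^+ i.
  by apply: eq_bigr => i _; rewrite (IH i).
rewrite S in H1; move: {H1}(H1 tr) {H2}(H2 tr'); set s := \sum_(i < m) _.
set y := f _ => H1 H2.
have -> : (c m - c' m) * t%:C%C ^+ m =
  (y - (s + c' m * t%:C%C ^+ m)) - (y - (s + c m * t%:C%C ^+ m)) by ring.
apply: le_trans (normcB _ _) _; apply: le_trans (lerD H2 H1) _.
by rewrite -mulrDl -mulrA -exprS [K' + K]addrC.
Qed.

Lemma aexp_lin f g q c c' (k : C) : aexp f q c -> aexp g q c' ->
  aexp (fun z => f z + k * g z) q (fun n => c n + k * c' n).
Proof.
move=> fc gc n; have [K [r r0 HK]] := fc n; have [K' [r' r'0 HK']] := gc n.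
exists (K + normc k * K'), (Num.min r r'); first by rewrite lt_min r0.
move=> w; rewrite lt_min => /andP[/HK H1 /HK' H2].
rewrite (eq_bigr (fun i : 'I_n => c i * w ^+ i + k * (c' i * w ^+ i))); last first.
  by move=> i _; rewrite mulrDl mulrA.
rewrite big_split /= -mulr_sumr.
have -> (a b u v : C) : a + k * b - (u + k * v) = (a - u) + k * (b - v) by ring.
apply: le_trans (normcD _ _) _; rewrite mulrDl normcM -mulrA lerD//.
by rewrite ler_wpM2l ?normc_ge0.
Qed.

Lemma aexp_local f g q c (r : R) : 0 < r ->
  (forall w, normc w < r -> f (q + w) = g (q + w)) -> aexp f q c -> aexp g q c.
Proof.
move=> r0 fg fc n; have [K [r' r'0 HK]] := fc n.
exists K, (Num.min r r'); first by rewrite lt_min r0.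
by move=> w; rewrite lt_min => /andP[/fg <-]; exact: HK.
Qed.

Lemma aexp0 q : aexp (fun=> 0) q (fun=> 0).
Proof.
move=> n; exists 0, 1 => // w _; rewrite big1 ?subr0 ?mul0r//.
  by rewrite ComplexField.Normc.normc0.
by move=> i _; rewrite mul0r.
Qed.

Lemma geometric_aexp f q c (a B : R) : 0 < a -> 0 <= B ->
  (forall n w, normc w < a -> normc (f (q + w) - \sum_(k < n) c k * w ^+ k) <=
     B / (a - normc w) * (normc w / a) ^+ n) ->
  aexp f q c.
Proof.
move=> a0 B0 H n; exists (B / (a / 2) * (a ^+ n)^-1), (a / 2); first by rewrite divr_gt0.
move=> w wa; have wa' : normc w < a by lra.
apply: le_trans (H n w wa') _; rewrite expr_div_n -[leRHS]mulrA [(a ^+ n)^-1 * _]mulrC.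
rewrite ler_wpM2r ?mulr_ge0 ?exprn_ge0 ?invr_ge0 ?exprn_ge0 ?normc_ge0 ?(ltW a0)//.
rewrite ler_wpM2l// lef_pV2 ?posrE ?subr_gt0 ?divr_gt0//; lra.
Qed.

Lemma taylor_aexp f q (a M : R) : 0 < a ->
  (forall z, normc (z - q) <= 2 * a -> derivable f z 1 /\ normc (f z) <= M) ->
  exists c, [/\ aexp f q c, (forall k, normc (c k) * a ^+ k <= 8 * M) &
    forall n w, normc w < a -> normc (f (q + w) - \sum_(k < n) c k * w ^+ k) <=
      8 * a * M / (a - normc w) * (normc w / a) ^+ n].
Proof.
move=> a0 H; have M0 : 0 <= M.
  apply: le_trans (normc_ge0 (f q)) _; apply: (H q _).2.
  by rewrite subrr ComplexField.Normc.normc0 mulr_ge0// ltW.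
have [c [c1 c2]] := taylor a0 H; exists c; split=> //.
by apply: geometric_aexp c2 => //; rewrite !mulr_ge0// ltW.
Qed.

Lemma derivable_bounded f (U : set C) q : open U -> U q -> derivable_in f U ->
  exists r M : R, 0 < r /\
    forall z, normc (z - q) < r -> U z /\ normc (f z) <= M.
Proof.
move=> oU Uq df; have [e e0 He] := (open_normcP U).1 oU q Uq.
have /derivable_continuous cf := df q Uq.
have /cf /nbhs_normcP[a a0 Ha] : nbhs (f q) (disc (f q) 1).
  by apply/nbhs_normcP; exists 1.
exists (Num.min e a), (1 + normc (f q)); split; first by rewrite lt_min e0.
move=> z; rewrite lt_min => /andP[/He Uz /Ha fz]; split=> //.
by rewrite -lerBlDr; apply: le_trans (normcBB _ _) (ltW fz).
Qed.

Lemma ler_geom (a b c t : R) : 0 <= t < 1 -> (forall n, a <= b + c * t ^+ n) -> a <= b.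
Proof.
move=> /andP[t0 t1] H; apply/ler_addgt0Pr => e e0.
have : (fun n => c * t ^+ n) @ \oo --> c * 0.
  by apply: cvgM; [exact: cvg_cst|apply: cvg_expr; rewrite ger0_norm].
rewrite mulr0 => /cvgrPdist_lt /(_ e e0)[N _ HN].
have := HN N (leqnn N); rewrite /= sub0r normrN => h.
by apply: le_trans (H N) _; rewrite lerD2l; apply: le_trans (ler_norm _) (ltW h).
Qed.

Lemma holo_aexp f (U : set C) q : open U -> U q -> derivable_in f U ->
  exists c, aexp f q c.
Proof.
move=> oU Uq df; have [r [M [r0 H]]] := derivable_bounded oU Uq df.
have r40 : 0 < r / 4 by rewrite divr_gt0.
have [|c []] := @taylor_aexp f q (r / 4) M r40; last by exists c.
by move=> z zq; have [] := H z; [lra|split=> //; exact: df].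
Qed.

Definition vanishes_near h z := exists2 e : R, 0 < e &
  forall w, normc w < e -> h (z + w) = 0.

Lemma aexp0_vanishes h q c (a M : R) : 0 < a ->
  (forall z, normc (z - q) <= 2 * a -> derivable h z 1 /\ normc (h z) <= M) ->
  aexp h q c -> (forall k, c k = 0) -> forall z, normc (z - q) < a -> h z = 0.
Proof.
move=> a0 H hc c0 z zq; have [c' [hc' _ cb]] := taylor_aexp a0 H.
apply/eqP; rewrite -normc_eq0 eq_le normc_ge0 andbT.
apply: (@ler_geom _ _ (8 * a * M / (a - normc (z - q))) (normc (z - q) / a)).
  by rewrite divr_ge0 ?normc_ge0 ?(ltW a0)//= ltr_pdivrMr// mul1r.
move=> n; rewrite add0r; have := cb n _ zq; rewrite subrKC big1 ?subr0//.
by move=> k _; rewrite (aexp_unique hc' hc) c0 mul0r.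
Qed.

(** The radius of validity of the Taylor expansion is locally bounded below,
    so the expansion at a point [q] close to [z0] reaches [z0]. *)
Lemma vanishing_spreads h (U : set C) z0 : open U -> U z0 -> derivable_in h U ->
  exists2 e : R, 0 < e & forall q, normc (q - z0) < e -> vanishes_near h q ->
    forall z, normc (z - z0) < e -> h z = 0.
Proof.
move=> oU Uz0 dh; have [r [M [r0 H]]] := derivable_bounded oU Uz0 dh.
pose a := r / 4; have a0 : 0 < a by rewrite divr_gt0.
exists (r / 8); first by rewrite divr_gt0.
move=> q qz0 [e e0 He] z zz0.
have zq : normc (z - q) < a.
  by apply: le_lt_trans (normc_dist z0 _ _) _; rewrite [normc (z0 - q)]normcBC /a; lra.
apply: (@aexp0_vanishes h q _ a M a0 _ (aexp_local e0 _ (aexp0 q))) zq => //; last first.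
  by move=> w we; rewrite He.
move=> y yq; have [|Uy hM] := H y; last by split=> //; exact: dh.
by apply: le_lt_trans (normc_dist q _ _) _; rewrite /a in yq; lra.
Qed.

(** The points near which [f] and [g] agree form an open subset of [W], which is
    closed in [W] since expansions reach a uniform distance. *)
Lemma identity_theorem f g (W : set C) q : open W -> connected W -> W q ->
  derivable_in f W -> derivable_in g W ->
  vanishes_near (fun z => f z - g z) q -> forall z, W z -> f z = g z.
Proof.
move=> oW cW Wq df dg vq; pose h z := f z - g z.
have dh : derivable_in h W by move=> z Wz; exact: (derivable_sub (df z Wz) (dg z Wz)).
pose Z := [set z | W z /\ vanishes_near h z].
have oZ : open Z.
  apply/open_normcP => z [Wz [e e0 He]].
  have [e' e'0 He'] := (open_normcP W).1 oW z Wz.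
  exists (Num.min (e / 2) e'); first by rewrite lt_min divr_gt0.
  move=> w; rewrite lt_min => /andP[we /He' Ww]; split=> //.
  exists (e / 2); first by rewrite divr_gt0.
  move=> u ue; have := He (w - z + u); rewrite addrA subrKC; apply.
  by apply: le_lt_trans (normcD _ _) _; lra.
have ZW : Z = W.
  apply: cW; first by exists q.
    by exists Z => //; rewrite setIidr// => z [].
  exists (closure Z); first exact: closed_closure.
  apply/seteqP; split=> z; first by move=> Zz; split; [case: Zz|exact: subset_closure].
  move=> [Wz /closure_normcP cz]; split=> //.
  have [e e0 He] := vanishing_spreads oW Wz dh.
  have [w [Ww vw] we] := cz e e0.
  exists e => // u ue; apply: (He w we vw).
  by rewrite [z + u]addrC addrK.
move=> z; rewrite -ZW => -[_ [e e0 He]]; apply/eqP; rewrite -subr_eq0.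
by have := He 0; rewrite addr0 ComplexField.Normc.normc0 => /(_ e0) /eqP.
Qed.

End AsymptoticExpansion.

(** * Series of holomorphic functions *)

Section SeriesOfHolomorphic.
Context {R : realType}.
Local Notation C := (Cplx R).
Local Notation Re := (@complex.Re R).
Local Notation Im := (@complex.Im R).
Implicit Types (z w q : C) (c : nat -> C).

(** [x n - T n] increases and [x n + T n] decreases when [T] is the tail of the
    geometric series, so the intervals between them are nested. *)
Lemma real_geom_limit (x : nat -> R) (B t : R) : 0 <= t < 1 ->
  (forall n, `|x n.+1 - x n| <= B * t ^+ n) ->
  exists L, forall n, `|L - x n| <= B / (1 - t) * t ^+ n.
Proof.
move=> /andP[t0 t1] H; pose T n := B / (1 - t) * t ^+ n.
have TS n : T n - T n.+1 = B * t ^+ n by rewrite /T exprS; field; rewrite subr_eq0 gt_eqF.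
have B0 : 0 <= B by have := H 0%N; rewrite expr0 mulr1; apply: le_trans.
have T0 n : 0 <= T n by rewrite !mulr_ge0 ?exprn_ge0// invr_ge0 subr_ge0 ltW.
have [||n|L HL] := @nested_intervals _ (fun n => x n - T n) (fun n => x n + T n).
- by move=> n; have := H n; rewrite -TS ler_norml => /andP[]; lra.
- by move=> n; have := H n; rewrite -TS ler_norml => /andP[]; lra.
- by have := T0 n; lra.
by exists L => n; have := HL n; rewrite -/(T n) ler_norml => /andP[]; lra.
Qed.

Lemma geom_limit (S : nat -> C) (B t : R) : 0 <= t < 1 ->
  (forall n, normc (S n.+1 - S n) <= B * t ^+ n) ->
  exists L, forall n, normc (L - S n) <= 2 * B / (1 - t) * t ^+ n.
Proof.
move=> t01 H.
have [n|p Hp] := @real_geom_limit (fun n => Re (S n)) B t t01.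
  by apply: le_trans (H n); rewrite -raddfB Re_le_normc.
have [n|r Hr] := @real_geom_limit (fun n => Im (S n)) B t t01.
  by apply: le_trans (H n); rewrite -raddfB Im_le_normc.
exists (Complex p r) => n; apply: le_trans (normc_le_ReIm _) _.
rewrite !raddfB /= -!mulrA mulr_natl mulr2n mulrA.
exact: lerD (Hp n) (Hr n).
Qed.

(** The second order errors of the terms sum up to [K * normc h ^+ 2] with the
    same [K] for all partial sums, and such a bound passes to the limit.  Power
    series and series of poles are the two instances. *)
Lemma series_derivable (u : nat -> C -> C) (d : nat -> C) z0 (B t r : R) (F : C -> C) :
  0 < r -> 0 <= t < 1 ->
  (forall n h, normc h < r ->
     normc (u n (z0 + h) - u n z0 - h * d n) <= normc h ^+ 2 * (B * t ^+ n)) ->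
  (forall n, normc (d n) <= B * t ^+ n) ->
  (forall n h, normc h < r ->
     normc (F (z0 + h) - \sum_(k < n) u k (z0 + h)) <= B * t ^+ n) ->
  derivable F z0 1.
Proof.
move=> r0 t01 Hu Hd HF; have /andP[t0 t1] := t01.
have B0 : 0 <= B by have := Hd 0%N; rewrite expr0 mulr1; apply: le_trans (normc_ge0 _).
have [n|D HD] := @geom_limit (fun n => \sum_(k < n) d k) B t t01.
  by rewrite /= big_ord_recr /= [_ + d n]addrC addrK.
pose K := B / (1 - t).
have t10 : 0 < 1 - t by rewrite subr_gt0.
have K0 : 0 <= K by rewrite divr_ge0// ltW.
have geo n : \sum_(k < n) B * t ^+ k <= K.
  rewrite -mulr_sumr /K ler_wpM2l// -[(1 - t)^-1]mul1r ler_pdivlMr// mulrC.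
  by rewrite -[leLHS]opprK -mulNr opprB -subrX1 opprB gerBl exprn_ge0.
have quad h : normc h < r -> normc (F (z0 + h) - F z0 - h * D) <= K * normc h ^+ 2.
  move=> hr; apply: (@ler_geom _ _ _ (2 * B + normc h * (2 * B / (1 - t))) t t01) => n.
  have F1 := HF n h hr; have := HF n 0.
  rewrite addr0 ComplexField.Normc.normc0 => /(_ r0) F0; have D0 := HD n.
  have S : normc (\sum_(k < n) u k (z0 + h) - \sum_(k < n) u k z0 -
      h * \sum_(k < n) d k) <= K * normc h ^+ 2.
    apply: (@le_trans _ _ (normc h ^+ 2 * \sum_(k < n) B * t ^+ k)); last first.
      by rewrite mulrC ler_wpM2r ?exprn_ge0 ?normc_ge0.
    elim: n {F1 F0 D0} => [|n IH].
      by rewrite !big_ord0 subrr !mulr0 subrr ComplexField.Normc.normc0.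
    rewrite !big_ord_recr /=.
    have -> (a b c a' b' c' : C) : a + a' - (b + b') - h * (c + c') =
      (a - b - h * c) + (a' - b' - h * c') by ring.
    by apply: le_trans (normcD _ _) _; rewrite mulrDr lerD// Hu.
  move: F1 F0 D0 S; set a1 := \sum_(k < n) u k (z0 + h); set a0 := \sum_(k < n) u k z0.
  set dn := \sum_(k < n) d k => F1 F0 D0 S.
  have -> : F (z0 + h) - F z0 - h * D = (F (z0 + h) - a1) - (F z0 - a0) +
    (a1 - a0 - h * dn) - h * (D - dn) by ring.
  apply: le_trans (normcB _ _) _; rewrite normcM.
  have Dh : normc h * normc (D - dn) <= normc h * (2 * B / (1 - t) * t ^+ n).
    by rewrite ler_wpM2l ?normc_ge0.
  have T1 := normcD ((F (z0 + h) - a1) - (F z0 - a0)) (a1 - a0 - h * dn).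
  have T2 := normcB (F (z0 + h) - a1) (F z0 - a0).
  move: F1 F0 S Dh T1 T2; clear; set Q := 2 * B / (1 - t).
  lra.
apply/cdiffP; exists D => e e0; exists (Num.min r (e / (K + 1))).
  by rewrite lt_min r0 divr_gt0// ltr_wpDl.
move=> h; rewrite lt_min => /andP[hr he]; apply: le_trans (quad h hr) _.
rewrite expr2 mulrA ler_wpM2r ?normc_ge0//.
apply: (@le_trans _ _ ((K + 1) * normc h)).
  by rewrite ler_wpM2r ?normc_ge0// lerDl.
by rewrite mulrC -ler_pdivlMr ?ltr_wpDl// ltW.
Qed.

(** In the binomial expansion [|h| ^ i <= (|h| / a) a ^ i] for [i >= 1], and with
    the square of [|h| / a] for [i >= 2] in the next lemma; the remaining sum is
    at most [(|x| + a) ^ k].  Induction on [k] replaces the expansion. *)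
Lemma powerB_bound (x h : C) (a : R) k : 0 < a -> normc h <= a ->
  normc ((x + h) ^+ k - x ^+ k) <= normc h / a * (normc x + a) ^+ k.
Proof.
move=> a0 ha; elim: k => [|k IH].
  by rewrite !expr0 subrr ComplexField.Normc.normc0 mulr1 divr_ge0 ?normc_ge0// ltW.
have -> : (x + h) ^+ k.+1 - x ^+ k.+1 = x * ((x + h) ^+ k - x ^+ k) + h * (x + h) ^+ k.
  by rewrite !exprS; ring.
apply: le_trans (normcD _ _) _; rewrite !normcM normcX exprS.
have -> : normc h / a * ((normc x + a) * (normc x + a) ^+ k) =
  normc x * (normc h / a * (normc x + a) ^+ k) + normc h * (normc x + a) ^+ k.
  by field; rewrite gt_eqF.
apply: lerD; first by rewrite ler_wpM2l ?normc_ge0.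
rewrite ler_wpM2l ?normc_ge0// lerXn2r ?nnegrE ?normc_ge0 ?addr_ge0 ?normc_ge0 ?(ltW a0)//.
by apply: le_trans (normcD _ _) _; rewrite lerD2l.
Qed.

Lemma powerD_bound (x h : C) (a : R) k : 0 < a -> normc h <= a ->
  normc ((x + h) ^+ k - x ^+ k - h * (k%:R * x ^+ k.-1)) <=
    (normc h / a) ^+ 2 * (normc x + a) ^+ k.
Proof.
move=> a0 ha; elim: k => [|k IH].
  rewrite !expr0 subrr mul0r mulr0 subrr ComplexField.Normc.normc0 mulr1.
  by rewrite exprn_ge0// divr_ge0 ?normc_ge0// ltW.
have xk : k%:R * x ^+ k = x * (k%:R * x ^+ k.-1) :> C.
  by case: k {IH} => [|k]; rewrite ?mul0r ?mulr0//= exprS mulrCA.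
have -> : (x + h) ^+ k.+1 - x ^+ k.+1 - h * (k.+1%:R * x ^+ k) =
    x * ((x + h) ^+ k - x ^+ k - h * (k%:R * x ^+ k.-1)) +
    h * ((x + h) ^+ k - x ^+ k).
  by rewrite -natr1 [(_ + 1) * _]mulrDl xk !exprS; ring.
apply: le_trans (normcD _ _) _; rewrite !normcM [(normc x + a) ^+ k.+1]exprS.
have -> : (normc h / a) ^+ 2 * ((normc x + a) * (normc x + a) ^+ k) =
  normc x * ((normc h / a) ^+ 2 * (normc x + a) ^+ k) +
  normc h * (normc h / a * (normc x + a) ^+ k).
  by field; rewrite gt_eqF.
apply: lerD; first by rewrite ler_wpM2l ?normc_ge0.
by rewrite ler_wpM2l ?normc_ge0// powerB_bound.
Qed.

Lemma power_deriv_bound (x : C) (a : R) k : 0 < a ->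
  normc (k%:R * x ^+ k.-1) <= (normc x + a) ^+ k / a.
Proof.
move=> a0; have s0 : 0 <= normc x + a by rewrite addr_ge0 ?normc_ge0// ltW.
rewrite ler_pdivlMr//; elim: k => [|k IH].
  by rewrite mul0r ComplexField.Normc.normc0 mul0r expr0.
have xk : k%:R * x ^+ k = x * (k%:R * x ^+ k.-1) :> C.
  by case: k {IH} => [|k]; rewrite ?mul0r ?mulr0//= exprS mulrCA.
have -> : k.+1%:R * x ^+ k = x * (k%:R * x ^+ k.-1) + x ^+ k by rewrite -natr1 mulrDl xk mul1r.
apply: (@le_trans _ _ ((normc x * normc (k%:R * x ^+ k.-1) + normc x ^+ k) * a)).
  by rewrite ler_wpM2r ?(ltW a0)// -normcX -normcM normcD.
rewrite exprS !mulrDl -mulrA; apply: lerD; first by rewrite ler_wpM2l ?normc_ge0.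
by rewrite mulrC ler_wpM2l ?(ltW a0)// lerXn2r ?nnegrE ?normc_ge0// lerDl ltW.
Qed.

(** [F] is chosen pointwise as a limit of partial sums; at a point of the disc the
    terms and their derivatives are compared with a geometric series whose
    ratio is fixed by a slightly larger circle. *)
Lemma power_series q c (r M : R) : 0 < r -> (forall k, normc (c k) * r ^+ k <= M) ->
  exists F : C -> C, derivable_in F (disc q r) /\ aexp F q c.
Proof.
move=> r0 cM.
have M0 : 0 <= M by apply: le_trans (cM 0%N); rewrite mulr_ge0 ?normc_ge0.
have cM' k (s : R) : 0 <= s -> normc (c k) * s ^+ k <= M * (s / r) ^+ k.
  move=> s0; rewrite expr_div_n mulrA [M * _]mulrC -mulrA [normc _ * _]mulrC.
  by rewrite ler_wpM2l ?exprn_ge0// ler_pdivlMr ?exprn_gt0.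
pose S z n : C := \sum_(k < n) c k * (z - q) ^+ k.
have ex z : exists L, normc (z - q) < r -> forall n,
    normc (L - S z n) <= 2 * M / (1 - normc (z - q) / r) * (normc (z - q) / r) ^+ n.
  have [zr|zr] := ltP (normc (z - q)) r; last by exists 0.
  have [||L HL] := @geom_limit (S z) M (normc (z - q) / r).
  - by rewrite divr_ge0 ?normc_ge0 ?(ltW r0)//= ltr_pdivrMr// mul1r.
  - move=> n; rewrite /S big_ord_recr /= [X in normc (X - _)]addrC addrK normcM normcX.
    by rewrite cM' ?normc_ge0.
  by exists L.
have {ex}[F HF] := choice ex.
have HFs z n (s : R) : normc (z - q) <= s -> s < r ->
    normc (F z - S z n) <= 2 * M / (1 - s / r) * (s / r) ^+ n.
  move=> zs sr; have zr := le_lt_trans zs sr; apply: le_trans (HF z zr n) _.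
  have zsr : normc (z - q) / r <= s / r by rewrite ler_pM2r ?invr_gt0.
  have s1 : 0 < 1 - s / r by rewrite subr_gt0 ltr_pdivrMr// mul1r.
  apply: ler_pM.
  - by rewrite mulr_ge0 ?mulr_ge0// invr_ge0; lra.
  - by rewrite exprn_ge0// divr_ge0 ?normc_ge0// ltW.
  - by rewrite ler_wpM2l ?mulr_ge0// lef_pV2 ?posrE//; lra.
  - by rewrite lerXn2r ?nnegrE ?divr_ge0 ?normc_ge0 ?(le_trans (normc_ge0 _) zs) ?(ltW r0).
exists F; split.
  move=> z0; rewrite /disc /= => z0r.
  (* half the distance to the boundary; all estimates hold on the disc of
     radius [s = normc x + a < r] *)
  set x := z0 - q in z0r; pose a := (r - normc x) / 2.
  have a0 : 0 < a by rewrite divr_gt0// subr_gt0.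
  have sr : normc x + a < r by rewrite /a; lra.
  have s0 : 0 <= normc x + a by rewrite addr_ge0 ?normc_ge0// ltW.
  set s := normc x + a in sr s0; pose t := s / r.
  have t01 : 0 <= t < 1.
    by rewrite divr_ge0 ?s0 ?(ltW r0)//= ltr_pdivrMr// mul1r.
  have /andP[t0 t1] := t01; have t10 : 0 < 1 - t by rewrite subr_gt0.
  pose B := M / a ^+ 2 + M / a + 2 * M / (1 - t).
  have B1 : 0 <= M / a ^+ 2 by rewrite divr_ge0 ?exprn_ge0// ltW.
  have B2 : 0 <= M / a by rewrite divr_ge0// ltW.
  have B3 : 0 <= 2 * M / (1 - t) by rewrite divr_ge0 ?mulr_ge0// ltW.
  have tn n : 0 <= t ^+ n by rewrite exprn_ge0.
  apply: (@series_derivable (fun k z => c k * (z - q) ^+ k)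
      (fun k => c k * (k%:R * x ^+ k.-1)) z0 B t a) => //.
  - move=> n h /ltW ha; have -> : z0 + h - q = x + h by rewrite /x; ring.
    have -> : c n * (x + h) ^+ n - c n * (z0 - q) ^+ n - h * (c n * (n%:R * x ^+ n.-1)) =
      c n * ((x + h) ^+ n - x ^+ n - h * (n%:R * x ^+ n.-1)) by rewrite -/x; ring.
    rewrite normcM; apply: (@le_trans _ _ (normc (c n) * ((normc h / a) ^+ 2 * s ^+ n))).
      by rewrite ler_wpM2l ?normc_ge0// powerD_bound.
    rewrite mulrCA expr_div_n -mulrA ler_wpM2l ?exprn_ge0 ?normc_ge0//.
    apply: (@le_trans _ _ ((a ^+ 2)^-1 * (M * t ^+ n))).
      by rewrite ler_wpM2l ?invr_ge0 ?exprn_ge0 ?(ltW a0)// cM'.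
    by rewrite mulrCA mulrA ler_wpM2r// /B; lra.
  - move=> n; rewrite normcM.
    apply: (@le_trans _ _ (normc (c n) * (s ^+ n / a))).
      by rewrite ler_wpM2l ?normc_ge0// power_deriv_bound.
    rewrite mulrA; apply: (@le_trans _ _ (M * t ^+ n / a)).
      by rewrite ler_wpM2r ?invr_ge0 ?(ltW a0)// cM'.
    by rewrite mulrAC ler_wpM2r// /B; lra.
  - move=> n h ha; apply: (@le_trans _ _ (2 * M / (1 - t) * t ^+ n)).
      apply: HFs => //; have -> : z0 + h - q = x + h by rewrite /x; ring.
      by apply: le_trans (normcD _ _) _; rewrite lerD2l ltW.
    by rewrite ler_wpM2r// /B; lra.
apply: (@geometric_aexp _ _ _ _ r (2 * M * r)) => //.
  by rewrite !mulr_ge0// ltW.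
move=> n w wr; have := HF (q + w); rewrite /S [q + w]addrC addrK => /(_ wr n).
congr (_ <= _ * _); field; rewrite !gt_eqF//= subr_gt0//.
Qed.

End SeriesOfHolomorphic.

(** * Extendability in terms of Taylor coefficients *)

Section Extendability.
Context {R : realType}.
Local Notation C := (Cplx R).
Local Notation Re := (@complex.Re R).
Local Notation Im := (@complex.Im R).
Implicit Types (f g F : C -> C) (z w q p : C) (c : nat -> C) (U W Omega K : set C).

Lemma connected_disc q (r : R) : 0 < r -> connected (disc q r).
Proof.
move=> r0; pose ray w := (fun t : R => q + t%:C%C * (w - q)) @` `[0, 1]%classic : set C.
have -> : disc q r = \bigcup_(w in disc q r) ray w.
  apply/seteqP; split=> [w wr|_ [w wr [t /= + <-]]].
    by exists w => //; exists 1; rewrite /= ?in_itv /= ?lexx ?ler01// mul1r subrKC.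
  rewrite in_itv /= => /andP[t0 t1]; rewrite /disc /= [q + _]addrC addrK.
  rewrite normcM normc_real ger0_norm//; apply: le_lt_trans wr.
  by rewrite ler_piMl ?normc_ge0.
apply: bigcup_connected.
  exists q => w wr; exists 0; first by rewrite /= in_itv /= lexx ler01.
  by rewrite mul0r addr0.
move=> w wr; apply: connected_continuous_connected; first exact: segment_connected.
apply: continuous_subspaceT => t A /nbhs_normcP[e e0 sA].
apply/nbhs_ballP; exists (e / (normc (w - q) + 1)).
  by rewrite /= divr_gt0// ltr_wpDl ?normc_ge0.
move=> s; rewrite -ball_normE /= => ts; apply: sA.
have -> : q + s%:C%C * (w - q) - (q + t%:C%C * (w - q)) = (s - t)%:C%C * (w - q).
  by rewrite rmorphB /=; ring.
rewrite normcM normc_real distrC.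
move: ts; rewrite ltr_pdivlMr ?ltr_wpDl ?normc_ge0//; apply: le_lt_trans.
by rewrite ler_wpM2l// lerDl.
Qed.

Lemma component_absorbs (A B : set C) z w : connected_component A z w ->
  connected B -> B w -> B `<=` A -> B `<=` connected_component A z.
Proof.
by move=> /same_connected_component -> cB Bw BA; exact: connected_component_max.
Qed.

Lemma open_component (A : set C) z : open A -> open (connected_component A z).
Proof.
move=> oA; apply/open_normcP => w Ww.
have [e e0 He] := (open_normcP A).1 oA w (connected_component_sub Ww).
exists e => //; apply: (@component_absorbs _ (disc w e) z w Ww) => //.
- exact: connected_disc.
- exact: disc_center.
Qed.

Definition coef_bounded f q (r M : R) :=
  exists2 c, aexp f q c & forall k, normc (c k) * r ^+ k <= M.

Lemma aexp_eq_near f g U q c : open U -> U q -> derivable_in f U ->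
  derivable_in g U -> aexp f q c -> aexp g q c ->
  vanishes_near (fun z => f z - g z) q.
Proof.
move=> oU Uq df dg fc gc; pose h z := f z - g z.
have dh : derivable_in h U by move=> z Uz; exact: (derivable_sub (df z Uz) (dg z Uz)).
have [r [M [r0 H]]] := derivable_bounded oU Uq dh.
have r40 : 0 < r / 4 by rewrite divr_gt0.
exists (r / 4) => // w we.
have hc : aexp h q (fun n => c n + -1 * c n).
  apply: aexp_local r0 _ (aexp_lin (-1) fc gc) => u _.
  by rewrite mulN1r.
suff: h (q + w) = 0 by [].
apply: (@aexp0_vanishes _ h q _ (r / 4) M r40 _ hc _ (q + w)).
- by move=> z zq; have [] := H z; [lra|split=> //; exact: dh].
- by move=> k; rewrite mulN1r subrr.
- by rewrite [q + w]addrC addrK.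
Qed.

(** The sum of the Taylor series is holomorphic on a disc that leaves [Omega]; it
    agrees with [f] near [q], hence on the component of [q]. *)
Lemma extendable_of_coef_bounded f Omega q p (r M : R) :
  open Omega -> derivable_in f Omega -> Omega q -> 0 < r ->
  disc q r p -> ~ Omega p -> coef_bounded f q r M -> extendable Omega f.
Proof.
move=> oO df Oq r0 pr nOp [c fc cM].
have [F [dF Fc]] := power_series q r0 cM.
pose U := disc q r; pose W := connected_component (U `&` Omega) q.
have oU : open U by exact: open_disc.
have Uq : U q by exact: disc_center.
have UOq : (U `&` Omega) q by split.
have oUO : open (U `&` Omega) by exact: openI.
have sW : W `<=` U `&` Omega := @connected_component_sub _ _ _.
exists U, F, W; split; first split => //.
- exact: connected_disc.
- by exists q.
- by exists p.
split=> //; first by exists q.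
apply: (@identity_theorem _ F f W q).
- exact: open_component.
- exact: component_connected.
- exact: connected_component_refl.
- by move=> z /sW[/dF].
- by move=> z /sW[_ /df].
- apply: (aexp_eq_near oUO UOq) Fc fc; first by move=> z [/dF].
  by move=> z [_ /df].
Qed.

Lemma rat_near (x e : R) : 0 < e -> exists a : rat, `|ratr a - x| < e.
Proof.
move=> e0; have : x - e < x + e by lra.
move=> /rat_in_itvoo[a]; rewrite in_itv /= => /andP[a1 a2]; exists a.
by rewrite ltr_norml; apply/andP; split; lra.
Qed.

Definition ratC (a b : rat) : C := Complex (ratr a) (ratr b).

Lemma ratC_near z (e : R) : 0 < e -> exists a b, normc (ratC a b - z) < e.
Proof.
move=> e0; have e20 : 0 < e / 2 by rewrite divr_gt0.
have [a Ha] := rat_near (Re z) e20; have [b Hb] := rat_near (Im z) e20.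
exists a, b; apply: le_lt_trans (normc_le_ReIm _) _.
by rewrite !raddfB /=; lra.
Qed.

(** A component [W] of [U `&` Omega] that is not all of [U] accumulates at some
    point of [U] outside [Omega]. *)
Lemma component_escapes U Omega q0 : open U -> connected U -> open Omega ->
  (U `&` Omega) q0 -> U `&` ~` Omega !=set0 ->
  exists p, [/\ U p, ~ Omega p & closure (connected_component (U `&` Omega) q0) p].
Proof.
move=> oU cU oO UOq0 [p0 [Up0 nOp0]].
set W := connected_component (U `&` Omega) q0.
have oUO : open (U `&` Omega) by exact: openI.
have sW : W `<=` U `&` Omega := @connected_component_sub _ _ _.
have oW : open W by exact: open_component.
have Wq0 : W q0 by exact: connected_component_refl.
apply: contrapT => nex.
have WU : W = U.
  apply: cU; first by exists q0.
    by exists W => //; rewrite setIidr// => z /sW[].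
  exists (closure W); first exact: closed_closure.
  apply/seteqP; split=> z; first by move=> Wz; split; [case: (sW z Wz)|exact: subset_closure].
  move=> [Uz cz]; have [Oz|nOz] := pselect (Omega z); last by case: nex; exists z.
  have [e e0 He] := (open_normcP _).1 oUO z (conj Uz Oz).
  have [w Ww we] := (closure_normcP W z).1 cz e e0.
  apply: (@component_absorbs _ (disc z e) q0 w Ww) => //; first exact: connected_disc.
  exact: disc_center.
by move: Up0; rewrite -WU => /sW[].
Qed.

(** An extension [F] is holomorphic around a point [p] outside [Omega] that is a
    limit of the component [W].  Cauchy's estimates for [F] at a point [q] of [W]
    very close to [p] hold on a disc around [q] that contains [p]. *)
Lemma coef_bounded_of_extendable f Omega : open Omega -> extendable Omega f ->
  exists a b s : rat, exists M : nat, [/\ Omega (ratC a b), 0 < ratr s :> R,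
    (exists2 p, disc (ratC a b) (ratr s) p & ~ Omega p) &
    coef_bounded f (ratC a b) (ratr s) M%:R].
Proof.
move=> oO [U [F [W [[oU cU [q0 UOq0] nU] [dF [q1 UOq1 WE] FW]]]]].
have [p [Up nOp]] := component_escapes oU cU oO UOq1 nU.
rewrite -WE => /closure_normcP clp.
have oW : open W by rewrite WE; apply/open_component/openI.
have [r [M [r0 H]]] := derivable_bounded oU Up dF.
(* [normc (q - p) < r' < s < 2 r'], so that the disc of radius [2 s] around [q]
   stays in the disc of radius [5 r'] around [p] *)
pose r' := r / 10; have r'0 : 0 < r' by rewrite divr_gt0.
have [w Ww wp] := clp r' r'0.
have [e e0 He] := (open_normcP W).1 oW w Ww.
have [|a [b abw]] := @ratC_near w (Num.min e (r' - normc (w - p))).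
  by rewrite lt_min e0 subr_gt0.
move: abw; rewrite lt_min => /andP[/He Wq wq]; set q := ratC a b in Wq wq *.
have qp : normc (q - p) < r' by apply: le_lt_trans (normc_dist w _ _) _; lra.
have [s Hs] : exists s : rat, r' < ratr s < 2 * r'.
  have : r' < 2 * r' by lra.
  by move=> /rat_in_itvoo[s]; rewrite in_itv /= => Hs; exists s.
have /andP[s1 s2] := Hs; have s0 : 0 < ratr s :> R by exact: lt_trans s1.
have [|c [Fc cM _]] := @taylor_aexp _ F q (ratr s) M s0.
  move=> z zq; have [|Uz FM] := H z; last by split=> //; exact: dF.
  by apply: le_lt_trans (normc_dist q _ _) _; rewrite /r' in s2 qp; lra.
have Oq : Omega q by move: Wq; rewrite WE => /connected_component_sub[].
exists a, b, s, (Num.bound `|8 * M|); split => //.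
- by exists p => //; rewrite /disc /= normcBC; apply: lt_trans s1.
- exists c.
    have [d d0 Hd] := (open_normcP W).1 oW q Wq.
    by apply: aexp_local d0 _ Fc => u ud; apply/FW/Hd; rewrite [q + u]addrC addrK.
  move=> k; apply: le_trans (cM k) _; apply: ltW; apply: le_lt_trans (ler_norm _) _.
  exact/archi_boundP/normr_ge0.
Qed.

Lemma compact_rect (x0 x1 y0 y1 : R) : compact (rect x0 x1 y0 y1).
Proof.
pose f (xy : R * R) : C := Complex xy.1 xy.2.
have -> : rect x0 x1 y0 y1 = f @` (`[x0, x1] `*` `[y0, y1]).
  apply/seteqP; split=> [[x y] [hx hy]|_ [[x y] [/= hx hy] <-]].
    by exists (x, y); split; rewrite //= in_itv.
  by move: hx hy; rewrite !in_itv.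
apply: continuous_compact; last by apply: compact_setX; exact: segment_compact.
apply: continuous_subspaceT => -[x y] A /nbhs_normcP[e e0 sA].
exists (ball x (e / 2), ball y (e / 2)).
  by split; apply: nbhsx_ballx; rewrite divr_gt0.
move=> [x' y'] [/=]; rewrite -!ball_normE /= => hx hy; apply: sA.
apply: le_lt_trans (normc_le_ReIm _) _ => /=.
by rewrite distrC [`|y' - y|]distrC; lra.
Qed.

(** The Lebesgue number of the covering of [K] by the single open set [Omega]. *)
Lemma compact_margin K Omega : compact K -> open Omega -> K `<=` Omega ->
  exists2 d : R, 0 < d & forall z, K z -> disc z d `<=` Omega.
Proof.
move=> /compact_near_coveringP cK oO KO.
have H : \forall d \near (0 : R)^'+, K `<=` [set z | disc z d `<=` Omega].
  apply: (cK R (0^'+) (fun d z => disc z d `<=` Omega)) => z /KO Oz.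
  have [e e0 He] := (open_normcP Omega).1 oO z Oz.
  exists (disc z (e / 2), [set d | d < e / 2]).
    split; first by apply/nbhs_normcP; exists (e / 2); rewrite ?divr_gt0.
    by apply: nbhs_right_lt; rewrite divr_gt0.
  move=> [z' d] [/= zz' de] w wz'; apply: He.
  by apply: le_lt_trans (normc_dist z' _ _) _; rewrite /disc /= in zz' wz'; lra.
near (0 : R)^'+ => d; exists d; first by near: d; exact: nbhs_right_gt.
near: d; exact: H.
Unshelve. all: by end_near. Qed.

End Extendability.

(** * Poles outside the domain *)

Section Poles.
Context {R : realType}.
Local Notation C := (Cplx R).
Implicit Types (f g G : C -> C) (z w q p : C) (c : nat -> C) (V Omega : set C).

(** The sets on which the coefficients at [q] are bounded are closed: by
    Cauchy's estimates coefficients depend continuously on the function. *)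
Lemma coef_unbounded_open Omega g q (r M a : R) :
  derivable_in g Omega -> 0 < r -> 0 < a ->
  (forall z, normc (z - q) <= 2 * a -> Omega z) -> ~ coef_bounded g q r M ->
  exists2 e : R, 0 < e & forall G, derivable_in G Omega ->
    (forall z, normc (z - q) <= 2 * a -> normc (G z - g z) <= e) ->
    ~ coef_bounded G q r M.
Proof.
move=> dg r0 a0 aO nb.
have Oq : open (disc q a) by exact: open_disc.
have dO h : derivable_in h Omega -> derivable_in h (disc q a).
  by move=> dh z za; apply/dh/aO; rewrite /disc /= in za; lra.
have [c gc] := holo_aexp Oq (disc_center q a0) (dO g dg).
have [k Hk] : exists k, M < normc (c k) * r ^+ k.
  apply: contrapT => nk; apply: nb; exists c => // k; rewrite leNgt.
  by apply/negP => ck; apply: nk; exists k.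
(* [e] is such that the k-th coefficient changes by at most half of what it
   exceeds the bound by *)
pose x := (r / a) ^+ k; have x0 : 0 < x by rewrite exprn_gt0// divr_gt0.
pose e := (normc (c k) * r ^+ k - M) / (16 * x).
have e0 : 0 < e by rewrite divr_gt0 ?subr_gt0// mulr_gt0.
exists e => // G dG Ge [c' Gc' c'M].
have [|c'' [hc'' cb _]] := @taylor_aexp _ (fun z => G z - g z) q a e a0.
  by move=> z za; split; [exact: derivable_sub (dG z (aO z za)) (dg z (aO z za))|exact: Ge].
have : aexp (fun z => G z - g z) q (fun n => c' n + -1 * c n).
  by apply: aexp_local a0 _ (aexp_lin (-1) Gc' gc) => w _; rewrite mulN1r.
move=> /(aexp_unique hc'') /(_ k) E.
have H1 := cb k; have H2 := c'M k.
have H3 : normc (c k) <= normc (c' k) + normc (c'' k).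
  have -> : c k = c' k - c'' k by rewrite E; ring.
  exact: normcB.
have rk : 0 < r ^+ k by rewrite exprn_gt0.
have H4 : normc (c k) * r ^+ k <= M + normc (c'' k) * r ^+ k.
  apply: le_trans (lerD H2 (lexx _)); rewrite -mulrDl ler_wpM2r//; exact: ltW.
have H5 : normc (c'' k) * r ^+ k <= 8 * e * x.
  have -> : r ^+ k = a ^+ k * x.
    by rewrite /x expr_div_n; field; rewrite expf_neq0// gt_eqF.
  by rewrite mulrA ler_wpM2r// ltW.
have : 8 * e * x = (normc (c k) * r ^+ k - M) / 2 by rewrite /e; field; rewrite gt_eqF.
lra.
Qed.

Lemma inner_radius Omega q : open Omega -> Omega q ->
  exists2 a : R, 0 < a & forall z, normc (z - q) <= 2 * a -> disc z a `<=` Omega.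
Proof.
move=> oO Oq; have [e e0 He] := (open_normcP Omega).1 oO q Oq.
exists (e / 4); first by rewrite divr_gt0.
move=> z zq w wz; apply: He; apply: le_lt_trans (normc_dist z _ _) _.
by rewrite /disc /= in wz; lra.
Qed.

Lemma geom_unbounded (A b x : R) : 0 < b -> 1 < x -> exists k, A < b * x ^+ k.
Proof.
move=> b0 x1; apply: contrapT => nk.
have x0 : 0 < x by apply: lt_trans x1.
suff : b <= 0 by rewrite leNgt b0.
apply: (@ler_geom _ _ _ A x^-1); first by rewrite invr_ge0 (ltW x0) invf_lt1.
move=> k; rewrite add0r exprVn ler_pdivlMr ?exprn_gt0// leNgt.
by apply/negP => h; apply: nk; exists k.
Qed.

(** The scale [s] makes the modulus at most 1 on [V]; being at most 1 itself, it
    also bounds the modulus by the inverse of the distance to the pole. *)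
Definition pole (s : R) w z : C := s%:C%C / (z - w).

Lemma derivable_pole s w z : z != w -> derivable (pole s w) z 1.
Proof.
move=> zw; apply: (@derivable_mul _ (fun=> s%:C%C)); first exact: derivable_cst.
exact: derivable_invB.
Qed.

(** The geometric series [s / (z - w) = - sum_k s u ^ k / (w - q) ^ (k + 1)] for
    [z = q + u]. *)
Lemma pole_aexp (s : R) w q : q != w -> 0 <= s ->
  aexp (pole s w) q (fun k => - s%:C%C / (w - q) ^+ k.+1).
Proof.
move=> qw s0; have W0 : w - q != 0 by rewrite subr_eq0 eq_sym.
have a0 : 0 < normc (w - q) by rewrite normc_gt0.
apply: (geometric_aexp a0 s0) => n u ua.
have Wu : w - q - u != 0 by rewrite subr_eq0; exact: normc_lt_neq ua (lexx _).
have -> : pole s w (q + u) - \sum_(k < n) - s%:C%C / (w - q) ^+ k.+1 * u ^+ k =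
    - s%:C%C * (u / (w - q)) ^+ n / (w - q - u).
  elim: n => [|n IH].
    rewrite big_ord0 subr0 expr0 mulr1 /pole -[q + u - w]opprK invrN mulrN mulNr.
    by congr (- (_ / _)); ring.
  rewrite big_ord_recr /= opprD addrA IH !exprS !expr_div_n; field.
  by rewrite W0 Wu expf_neq0.
rewrite !normcM normcN normc_real ger0_norm// normcX normcM !normcV.
rewrite mulrAC ler_wpM2r ?exprn_ge0 ?divr_ge0 ?normc_ge0//.
rewrite ler_wpM2l// lef_pV2 ?posrE ?subr_gt0 ?normc_gt0//; exact: normcBB.
Qed.

(** Boundedness of coefficients is preserved by linear combinations, and fails
    for a pole [w] in the disc: there the ratio [r / normc (w - q)] exceeds 1.
    Hence [g] or [g] plus any small multiple of the pole has unbounded ones. *)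
Lemma coef_unbounded_pole Omega g q (r M s e : R) w :
  Omega q -> disc q r w -> ~ Omega w ->
  0 < s -> 0 < e -> exists2 t : R, 0 <= t <= e &
    ~ coef_bounded (fun z => g z + t%:C%C * pole s w z) q r M.
Proof.
move=> Oq wr nOw s0 e0.
have [b|nb] := pselect (coef_bounded g q r M); last first.
  exists 0; first by rewrite lexx ltW.
  move=> [c gc cM]; apply: nb; exists c => //.
  by apply: aexp_local ltr01 _ gc => u _; rewrite mul0r addr0.
have [c gc cM] := b; exists e; first by rewrite lexx ltW.
move=> [c' gc' c'M].
have qw : q != w by apply: contra_notN nOw => /eqP <-.
have E := aexp_unique gc' (aexp_lin e%:C%C gc (pole_aexp qw (ltW s0))).
have a0 : 0 < normc (w - q) by rewrite normc_gt0 subr_eq0 eq_sym.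
set a := normc (w - q) in a0.
have r0 : 0 < r by apply: lt_trans wr.
(* the coefficients of [g] and of the sum account for at most [M] each *)
have [||k Hk] := @geom_unbounded (2 * M) (e * s / a) (r / a).
- by rewrite divr_gt0 ?mulr_gt0.
- by rewrite ltr_pdivlMr// mul1r.
have H1 := cM k; have H2 := c'M k; rewrite E in H2.
have H3 : normc (e%:C%C * (- s%:C%C / (w - q) ^+ k.+1)) <=
    normc (c k + e%:C%C * (- s%:C%C / (w - q) ^+ k.+1)) + normc (c k).
  rewrite -[X in normc X <= _](addKr (c k)) addrC; exact: normcB.
have rk : 0 <= r ^+ k by rewrite exprn_ge0// ltW.
have := ler_wpM2r rk H3; rewrite mulrDl !normcM normcV normcN normcX !normc_real.
rewrite !gtr0_norm// -/a => H4.
have E2 : e * (s / a ^+ k.+1) * r ^+ k = e * s / a * (r / a) ^+ k.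
  by rewrite exprS expr_div_n; field; rewrite expf_neq0 gt_eqF.
by rewrite E2 in H4; lra.
Qed.

Definition outer_dense V Omega := forall z, (closure V `&` boundary Omega) z ->
  forall e : R, 0 < e -> exists2 w, ~ closure Omega w & normc (w - z) < e.

(** A pole must avoid the closure of [V] for the function to be bounded on [V]: a
    boundary point in this closure is replaced by a nearby exterior point. *)
Lemma pole_position V Omega q p (r : R) : V `<=` Omega ->
  outer_dense V Omega -> disc q r p -> ~ Omega p ->
  exists w, [/\ disc q r w, ~ Omega w & ~ closure V w].
Proof.
move=> VO out pr nOp; have [cVp|ncVp] := pselect (closure V p); last by exists p.
have bp : (closure V `&` boundary Omega) p.
  by split=> //; split; [exact: closure_subset cVp|move=> /interior_subset].
have rp : 0 < r - normc (p - q) by rewrite subr_gt0.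
have [w nw wp] := out p bp _ rp; exists w; split.
- by apply: le_lt_trans (normc_dist p _ _) _; rewrite -ltrBrDr.
- by move=> /(@subset_closure _ Omega).
- by move=> cV; apply: nw; exact: closure_subset cV.
Qed.

Lemma pole_scale V w : ~ closure V w ->
  exists s : R, [/\ 0 < s, s <= 1 & forall z, V z -> s <= normc (z - w)].
Proof.
move=> /closure_normcP ncV.
have [e e0 He] : exists2 e : R, 0 < e & forall z, V z -> e <= normc (z - w).
  apply: contrapT => ne; apply: ncV => e e0; apply: contrapT => nz; apply: ne.
  exists e => // z Vz; rewrite leNgt; apply/negP => ze; apply: nz; by exists z.
exists (Num.min e 1); split; first by rewrite lt_min e0 ltr01.
  by rewrite ge_min lexx orbT.
by move=> z /He; apply: le_trans; rewrite ge_min lexx.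
Qed.

Lemma normc_pole_le (s D : R) w z : 0 <= s -> D * s <= normc (z - w) ->
  normc (pole s w z) * D <= 1.
Proof.
move=> s0 Ds; rewrite normcM normcV normc_real ger0_norm// mulrAC.
have [->|zw] := eqVneq (normc (z - w)) 0; first by rewrite invr0 mulr0 ler01.
rewrite ler_pdivrMr ?mul1r 1?mulrC//.
by rewrite lt_def zw normc_ge0.
Qed.

Lemma pole_second_order (s t d : R) w z h : 0 <= s <= 1 -> 0 <= t -> 0 < d ->
  d <= normc (z - w) -> d <= normc (z + h - w) ->
  normc (t%:C%C * pole s w (z + h) - t%:C%C * pole s w z -
     h * (- (t%:C%C * s%:C%C) / (z - w) ^+ 2)) <= normc h ^+ 2 * (t / d ^+ 3).
Proof.
move=> /andP[s0 s1] t0 d0 h1 h2.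
have z1 : z - w != 0 by rewrite -normc_gt0; exact: lt_le_trans h1.
have z2 : z + h - w != 0 by rewrite -normc_gt0; exact: lt_le_trans h2.
have -> : t%:C%C * pole s w (z + h) - t%:C%C * pole s w z -
     h * (- (t%:C%C * s%:C%C) / (z - w) ^+ 2) =
  h ^+ 2 * (t%:C%C * s%:C%C / ((z - w) ^+ 2 * (z + h - w))).
  by rewrite /pole; field; rewrite z1 z2.
rewrite normcM normcX ler_wpM2l ?exprn_ge0 ?normc_ge0//.
have n2 : normc ((z - w) ^+ 2 * (z + h - w)) = normc (z - w) ^+ 2 * normc (z + h - w).
  by rewrite normcM normcX.
rewrite normcM normcV n2 normcM !normc_real !ger0_norm//.
apply: ler_pM; rewrite ?mulr_ge0 ?invr_ge0 ?mulr_ge0 ?exprn_ge0 ?normc_ge0//.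
  by rewrite ler_piMr.
have d3 : d ^+ 3 <= normc (z - w) ^+ 2 * normc (z + h - w).
  by rewrite exprSr ler_pM ?exprn_ge0 ?(ltW d0)// lerXn2r ?nnegrE ?(ltW d0)// normc_ge0.
by rewrite lef_pV2 ?posrE ?exprn_gt0//; apply: lt_le_trans d3; rewrite exprn_gt0.
Qed.

End Poles.

(** * A non-extendable function near a given one *)

Section GlidingHump.
Context {R : realType}.
Local Notation C := (Cplx R).
Implicit Types (f g G : C -> C) (z w : C) (V Omega : set C).

(** Center [a + i b], radius and coefficient bound of a test.  Rational data are
    enough because the center can be moved slightly inside the component, and
    they make the tests countable. *)
Definition test : Type := rat * rat * rat * nat.
Definition test_center (x : test) : C := ratC x.1.1.1 x.1.1.2.
Definition test_radius (x : test) : R := ratr x.1.2.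

Definition admissible Omega (x : test) :=
  [/\ Omega (test_center x), 0 < test_radius x &
   exists2 p, disc (test_center x) (test_radius x) p & ~ Omega p].

Definition test_fails f (x : test) :=
  ~ coef_bounded f (test_center x) (test_radius x) x.2%:R.

Lemma nonextendableP f Omega : open Omega -> derivable_in f Omega ->
  ~ extendable Omega f <-> forall x, admissible Omega x -> test_fails f x.
Proof.
move=> oO df; split=> [ne x [Oq r0 [p pr nOp]] b|H].
  by apply: ne; exact: (extendable_of_coef_bounded oO df Oq r0 pr nOp b).
move=> /(coef_bounded_of_extendable oO)[a [b [s [M [Oq s0 hp cb]]]]].
exact: (H (a, b, s, M)).
Qed.

(** [e] is what remains available for the coefficients of all later poles.  After
    the coefficient [t] has made the test [x] fail, the amount is lowered to an
    [e'] for which the failure is stable. *)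
Lemma hump_step Omega (x : test) w (s : R) g (e : R) :
  open Omega -> ~ Omega w -> 0 < s ->
  (admissible Omega x -> disc (test_center x) (test_radius x) w) ->
  derivable_in g Omega -> 0 < e ->
  exists t e' : R, [/\ 0 <= t, t <= e / 2, 0 < e', e' <= e / 2 &
    admissible Omega x -> forall G, derivable_in G Omega ->
      (forall z (d : R), 0 < d -> disc z d `<=` Omega ->
         normc (G z - (g z + t%:C%C * pole s w z)) * d <= e') ->
      test_fails G x].
Proof.
move=> oO nOw s0 xw dg e0; have e20 : 0 < e / 2 by rewrite divr_gt0.
have [adm|nadm] := pselect (admissible Omega x); last first.
  by exists 0, (e / 2); split; rewrite // ltW.
have [Oq r0 _] := adm.
have [t /andP[t0 te] nb] :=
  @coef_unbounded_pole _ Omega g _ _ x.2%:R s _ w Oq (xw adm) nOw s0 e20.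
have dg' : derivable_in (fun z => g z + t%:C%C * pole s w z) Omega.
  move=> z Oz; have zw : z != w by apply: contra_notN nOw => /eqP <-.
  apply: (derivableD (dg z Oz)).
  apply: (@derivable_mul _ (fun=> t%:C%C)); first exact: derivable_cst.
  exact: derivable_pole.
have [a a0 Ha] := inner_radius oO Oq.
have aO z : normc (z - test_center x) <= 2 * a -> Omega z.
  by move=> /Ha; apply; exact: disc_center.
have [d d0 Hd] := coef_unbounded_open dg' r0 a0 aO nb.
exists t, (Num.min (e / 2) (d * a)); split=> //.
- by rewrite lt_min e20 mulr_gt0.
- by rewrite ge_min lexx.
move=> _ G dG HG; apply: (Hd G dG) => z zq.
rewrite -(ler_pM2r a0); apply: le_trans (HG z a a0 (Ha z zq)) _.
by rewrite ge_min lexx orbT.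
Qed.

(** Gliding hump: poles are added one after the other, each making one test
    fail, with coefficients so small that all later poles together cannot
    repair it.  As the amounts [h n] are at least halved, the coefficients from
    the n-th on sum up to at most [h n]. *)
Lemma nonextendable_near Omega V f (e : R) : open Omega -> V `<=` Omega ->
  outer_dense V Omega -> closure V `&` boundary Omega !=set0 ->
  derivable_in f Omega -> 0 < e ->
  exists F : C -> C, [/\ derivable_in F Omega, ~ extendable Omega F,
    (forall z, V z -> normc (F z - f z) <= e) &
    forall z (d : R), 0 < d -> disc z d `<=` Omega -> normc (F z - f z) * d <= e].
Proof.
move=> oO VO out [p0 mp0] df e0.
pose x n : test := odflt (0, 0, 0, 0%N) (unpickle n).
have exw n : exists ws : C * R, [/\ ~ Omega ws.1, 0 < ws.2 <= 1,
    (forall z, V z -> ws.2 <= normc (z - ws.1)) &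
    admissible Omega (x n) -> disc (test_center (x n)) (test_radius (x n)) ws.1].
  have [w [nOw ncV aw]] : exists w, [/\ ~ Omega w, ~ closure V w &
      admissible Omega (x n) -> disc (test_center (x n)) (test_radius (x n)) w].
    have [[Oq r0 [p pr nOp]]|na] := pselect (admissible Omega (x n)).
      by have [w [wr nOw ncV]] := pole_position VO out pr nOp; exists w.
    (* any exterior point will do when there is nothing to test *)
    have [w nw _] := out p0 mp0 1 ltr01; exists w; split=> //.
      by move=> /(@subset_closure _ Omega).
    by move=> cV; apply: nw; exact: closure_subset cV.
  have [s [s0 s1 sV]] := pole_scale ncV.
  by exists (w, s); split; rewrite //= s0.
have {exw}[ws Hws] := choice exw.
pose w n := (ws n).1; pose s n := (ws n).2.
have nOw n : ~ Omega (w n) by have [] := Hws n.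
have s0 n : 0 < s n by have [_ /andP[]] := Hws n.
have s1 n : s n <= 1 by have [_ /andP[]] := Hws n.
have sV n z : V z -> s n <= normc (z - w n) by have [_ _ + _] := Hws n; apply.
pose psi n := pole (s n) (w n).
pose P (i : nat * (C -> C) * R) (te : R * R) := derivable_in i.1.2 Omega -> 0 < i.2 ->
  [/\ 0 <= te.1, te.1 <= i.2 / 2, 0 < te.2, te.2 <= i.2 / 2 &
    admissible Omega (x i.1.1) -> forall G, derivable_in G Omega ->
      (forall z (d : R), 0 < d -> disc z d `<=` Omega ->
         normc (G z - (i.1.2 z + te.1%:C%C * psi i.1.1 z)) * d <= te.2) ->
      test_fails G (x i.1.1)].
have exs i : exists te, P i te.
  case: i => -[n g] h; have [h0|h0] := ltP 0 h; last first.
    by exists (0, 0) => _ /=; rewrite ltNge h0.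
  have [dg|ndg] := pselect (derivable_in g Omega); last by exists (0, 0) => /ndg.
  have [_ _ _ xw] := Hws n.
  have [t [h' H]] := hump_step oO (nOw n) (s0 n) xw dg h0.
  by exists (t, h').
have {exs}[step Hstep] := choice exs.
(* the n-th partial sum and the amount left for the poles that follow *)
pose state := fix st n : (C -> C) * R := if n is m.+1 then
  let i := (m, (st m).1, (st m).2) in
  ((fun z => (st m).1 z + (step i).1%:C%C * psi m z), (step i).2) else (f, e).
pose g n := (state n).1; pose h n := (state n).2.
pose t n := (step (n, g n, h n)).1.
have gS n z : g n.+1 z = g n z + (t n)%:C%C * psi n z by [].
have dpsi n z : Omega z -> derivable (psi n) z 1.
  by move=> Oz; apply: derivable_pole; apply: contra_notN (nOw n) => /eqP <-.
have inv n : derivable_in (g n) Omega /\ 0 < h n.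
  elim: n => [//|n [dg h0]]; have [_ _ h'0 _ _] := Hstep (n, g n, h n) dg h0.
  split; last exact: h'0.
  move=> z Oz; suff : derivable (fun z => g n z + (t n)%:C%C * psi n z) z 1 by [].
  apply: (derivableD (dg z Oz)).
  apply: (@derivable_mul _ (fun=> (t n)%:C%C)); first exact: derivable_cst.
  exact: dpsi.
have h0 n : 0 < h n by have [] := inv n.
have H n : [/\ 0 <= t n, t n <= h n / 2, h n.+1 <= h n / 2 &
    admissible Omega (x n) -> forall G, derivable_in G Omega ->
      (forall z (d : R), 0 < d -> disc z d `<=` Omega ->
         normc (G z - g n.+1 z) * d <= h n.+1) -> test_fails G (x n)].
  by have [dg _] := inv n; have [] := Hstep (n, g n, h n) dg (h0 n).
have t0 n : 0 <= t n by have [] := H n.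
have th n : t n <= h n / 2 by have [] := H n.
have hh n : h n.+1 <= h n / 2 by have [] := H n.
have hgeo n : h n <= e * 2^-1 ^+ n.
  elim: n => [|n IH]; first by rewrite expr0 mulr1.
  apply: le_trans (hh n) _; rewrite exprSr mulrA ler_wpM2r// invr_ge0//.
have half : 0 <= (2^-1 : R) < 1 by apply/andP; split; lra.
have tgeo n : t n <= e * 2^-1 ^+ n.
  by apply: le_trans (th n) (le_trans _ (hgeo n)); have := h0 n; lra.
(* [D^-1] bounds all the poles at [z]: the inverse of the distance to the
   complement of [Omega] in general, and 1 on [V] *)
have tail z (D : R) : 0 <= D -> (forall n, normc (psi n z) * D <= 1) ->
    forall n k, normc (g (n + k)%N z - g n z) * D + h (n + k)%N <= h n.
  move=> D0 HD n; elim=> [|k IH].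
    by rewrite addn0 subrr ComplexField.Normc.normc0 mul0r add0r.
  rewrite addnS gS; set m := (n + k)%N in IH *.
  have -> : g m z + (t m)%:C%C * psi m z - g n z =
    (g m z - g n z) + (t m)%:C%C * psi m z by ring.
  have N1 := normcD (g m z - g n z) ((t m)%:C%C * psi m z).
  have := ler_wpM2r D0 N1; rewrite mulrDl normcM normc_real ger0_norm// -mulrA => N2.
  have N3 : t m * (normc (psi m z) * D) <= t m by rewrite ler_piMr.
  by have := th m; have := hh m; lra.
(* the limit does not depend on [D], which ranges over all such constants *)
have exF z : exists L, forall D : R, 0 < D -> (forall n, normc (psi n z) * D <= 1) ->
    forall n, normc (L - g n z) * D <= h n.
  have [[D0 [D00 HD0]]|nD] :=
    pselect (exists D : R, 0 < D /\ forall n, normc (psi n z) * D <= 1); last first.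
    by exists 0 => D D0 HD; case: nD; exists D.
  have [n|L HL] := @geom_limit _ (fun n => g n z) (e / D0) 2^-1 half.
    rewrite gS [g n z + _]addrC addrK normcM normc_real ger0_norm// mulrAC.
    rewrite ler_pdivlMr// -mulrA; apply: le_trans (tgeo n).
    by rewrite ler_piMr.
  exists L => D D_gt0 HD n.
  apply: (@ler_geom _ _ _ (2 * (e / D0) / (1 - 2^-1) * D) 2^-1 half) => k.
  have T := tail z D (ltW D_gt0) HD n k.
  have hk := h0 (n + k)%N.
  have N1 : normc (L - g n z) <= normc (L - g (n + k)%N z) +
    normc (g (n + k)%N z - g n z) by exact: normc_dist.
  have N2 := ler_wpM2r (ltW D_gt0) N1; rewrite mulrDl in N2.
  have N3 : normc (L - g (n + k)%N z) * D <=
      2 * (e / D0) / (1 - 2^-1) * D * 2^-1 ^+ k.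
    rewrite mulrAC ler_wpM2r ?(ltW D_gt0)//; apply: le_trans (HL _) _.
    rewrite ler_wpM2l//.
      by rewrite !mulr_ge0 ?invr_ge0 ?(ltW e0) ?(ltW D00)//; lra.
    by rewrite exprD ler_piMl ?exprn_ge0 ?exprn_ile1 ?invr_ge0//; lra.
  by lra.
have {exF}[F HF] := choice exF.
have farw n z (d : R) : disc z d `<=` Omega -> d <= normc (z - w n).
  move=> dO; rewrite leNgt; apply/negP => wd; apply: (nOw n); apply: dO.
  by rewrite /disc /= normcBC.
have psiO n z (d : R) : 0 < d -> disc z d `<=` Omega -> normc (psi n z) * d <= 1.
  move=> d0 dO; apply: normc_pole_le; first exact: ltW.
  by apply: le_trans (farw n z d dO); rewrite ler_piMr// ltW.
have FO z (d : R) : 0 < d -> disc z d `<=` Omega ->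
    forall n, normc (F z - g n z) * d <= h n.
  by move=> d0 dO; apply: HF => // n; exact: psiO.
have dF : derivable_in F Omega.
  move=> z0 Oz0; have [r r0 Hr] := inner_radius oO Oz0.
  pose B := e / r + e / r ^+ 2 + e / r ^+ 3.
  have B1 : 0 <= e / r by rewrite divr_ge0// ltW.
  have B2 : 0 <= e / r ^+ 2 by rewrite divr_ge0 ?exprn_ge0// ltW.
  have B3 : 0 <= e / r ^+ 3 by rewrite divr_ge0 ?exprn_ge0// ltW.
  have near z : normc (z - z0) < r -> disc z r `<=` Omega.
    by move=> zr; apply: Hr; lra.
  have h2 n : 0 <= (2^-1 : R) ^+ n by rewrite exprn_ge0// invr_ge0.
  have sumE n z : \sum_(k < n) (t k)%:C%C * psi k z = g n z - f z.
    elim: n => [|n IH]; first by rewrite big_ord0 subrr.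
    by rewrite big_ord_recr /= IH gS addrAC.
  have dFf : derivable (fun z => F z - f z) z0 1.
    apply: (@series_derivable _ (fun n z => (t n)%:C%C * psi n z)
      (fun n => - ((t n)%:C%C * (s n)%:C%C) / (z0 - w n) ^+ 2) z0 B 2^-1 r) => //.
    - move=> n u ur.
      have zr : disc z0 r `<=` Omega.
        by apply: near; rewrite subrr ComplexField.Normc.normc0.
      have ur' : disc (z0 + u) r `<=` Omega by apply: near; rewrite [z0 + u]addrC addrK.
      apply: le_trans (pole_second_order _ (t0 n) r0 (farw n _ _ zr) (farw n _ _ ur')) _.
        by rewrite (ltW (s0 n)) s1.
      rewrite ler_wpM2l ?exprn_ge0 ?normc_ge0//.
      apply: (@le_trans _ _ (e * 2^-1 ^+ n / r ^+ 3)).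
        by rewrite ler_wpM2r ?invr_ge0 ?exprn_ge0// ltW.
      by rewrite mulrAC ler_wpM2r// /B; lra.
    - move=> n; rewrite normcM normcN normcM normcV normcX !normc_real !ger0_norm ?(ltW (s0 n))//.
      have zr : r <= normc (z0 - w n).
        by apply/farw/near; rewrite subrr ComplexField.Normc.normc0.
      apply: (@le_trans _ _ (e * 2^-1 ^+ n / r ^+ 2)); last first.
        by rewrite mulrAC ler_wpM2r// /B; lra.
      apply: ler_pM; rewrite ?mulr_ge0 ?invr_ge0 ?exprn_ge0 ?normc_ge0 ?(ltW (s0 n))//.
        by apply: le_trans (tgeo n); rewrite ler_piMr.
      rewrite lef_pV2 ?posrE ?exprn_gt0//; last exact: lt_le_trans zr.
      by rewrite lerXn2r ?nnegrE ?(ltW r0) ?normc_ge0.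
    - move=> n u ur; rewrite sumE.
      have -> : F (z0 + u) - f (z0 + u) - (g n (z0 + u) - f (z0 + u)) =
        F (z0 + u) - g n (z0 + u) by ring.
      have ur' : disc (z0 + u) r `<=` Omega by apply: near; rewrite [z0 + u]addrC addrK.
      have := FO _ r r0 ur' n; rewrite -ler_pdivlMr// => /le_trans; apply.
      apply: (@le_trans _ _ (e * 2^-1 ^+ n / r)).
        by rewrite ler_wpM2r ?invr_ge0 ?(ltW r0).
      by rewrite mulrAC ler_wpM2r// /B; lra.
  apply: (@near_derivable _ (fun z => (F z - f z) + f z) F z0 1 ltr01).
    by move=> z _; rewrite subrK.
  exact: derivableD dFf (df z0 Oz0).
exists F; split=> //.
- apply/(nonextendableP oO dF) => y adm.
  have [_ _ _] := H (pickle y); have -> : x (pickle y) = y by rewrite /x pickleK.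
  by apply=> // z d d0 dO; exact: FO.
- move=> z Vz; rewrite -[normc _]mulr1.
  apply: (HF z 1 ltr01 _ 0%N) => n.
  by apply: normc_pole_le; rewrite ?mul1r ?sV// ltW.
- by move=> z d d0 dO; exact: (FO z d d0 dO 0%N).
Qed.

End GlidingHump.

(** * The space of functions bounded on V *)

Section FunctionSpace.
Context {R : realType}.
Local Notation C := (Cplx R).
Implicit Types (f g F : C -> C) (z w : C) (A V Omega : set C) (K : nat -> set C).

Lemma bounded_normcP f A :
  [bounded f z | z in A] <-> exists M : R, forall z, A z -> normc (f z) <= M.
Proof.
split=> [[M [Mr H]]|[M H]].
  exists (complex.Re (M + 1)) => z Az.
  have := H (M + 1); rewrite ltrDl ltr01 => /(_ isT z Az) /=.
  by rewrite normr_normc lecE => /andP[].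
exists M%:C%C; split; first by apply/complex_realP; exists M.
move=> x Mx z Az /=; apply: le_trans (ltW Mx).
by rewrite normr_normc lecR; exact: H.
Qed.

Lemma supnorm_lt A f (e : R) : 0 < e -> (forall z, A z -> normc (f z) <= e / 2) ->
  (supnorm A f < e%:E)%E.
Proof.
move=> e0 H; apply: (@le_lt_trans _ _ (e / 2)%:E); last by rewrite lte_fin; lra.
by apply: ge_ereal_sup => _ [z Az <-]; rewrite lee_fin; exact: H.
Qed.

Lemma le_supnorm A f (e : R) z : (supnorm A f < e%:E)%E -> A z -> normc (f z) <= e.
Proof.
move=> fe Az; rewrite -lee_fin; apply: le_trans (ltW fe).
by apply: ereal_sup_ubound; exists z.
Qed.

(** Elements of the space vanish outside [Omega], whereas sums of poles do not. *)
Lemma bdd_holfun_restrict Omega V F f (e : R) : open Omega -> V `<=` Omega ->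
  bdd_holfun Omega V f -> derivable_in F Omega ->
  (forall z, V z -> normc (F z - f z) <= e) ->
  exists2 G, bdd_holfun Omega V G & forall z, Omega z -> G z = F z.
Proof.
move=> oO VO [_ /bounded_normcP[M fM]] dF Fe.
exists (fun z => if `[< Omega z >] then F z else 0); last first.
  by move=> z Oz; rewrite asboolT.
split; first split.
- move=> z Oz; have [d d0 Hd] := (open_normcP Omega).1 oO z Oz.
  by apply: near_derivable d0 _ (dF z Oz) => w /Hd Ow; rewrite asboolT.
- by move=> z nOz; rewrite asboolF.
- apply/bounded_normcP; exists (e + M) => z Vz; rewrite asboolT; last exact: VO.
  rewrite -[F z](subrK (f z)); apply: le_trans (normcD _ _) _.
  by rewrite lerD ?Fe ?fM.
Qed.

Lemma nonextendable_approx Omega V f (e : R) : open Omega -> V `<=` Omega ->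
  outer_dense V Omega -> closure V `&` boundary Omega !=set0 ->
  bdd_holfun Omega V f -> 0 < e ->
  exists G, [/\ bdd_holfun Omega V G, ~ extendable Omega G,
    (forall z, V z -> normc (G z - f z) <= e) &
    forall z (d : R), 0 < d -> disc z d `<=` Omega -> normc (G z - f z) * d <= e].
Proof.
move=> oO VO out mt Xf e0; have [[df _] _] := Xf.
have [F [dF nF FV FO]] := nonextendable_near oO VO out mt df e0.
have [G XG GF] := bdd_holfun_restrict oO VO Xf dF FV.
have dG : derivable_in G Omega by have [[]] := XG.
exists G; split=> //.
- apply/(nonextendableP oO dG) => x adm [c Gc cM].
  have [Oq _ _] := adm; have [r r0 Hr] := (open_normcP Omega).1 oO _ Oq.
  apply: ((nonextendableP oO dF).1 nF x adm); exists c => //.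
  by apply: aexp_local r0 _ Gc => w wr; rewrite GF//; apply: Hr; rewrite [_ + w]addrC addrK.
- by move=> z Vz; rewrite GF; [exact: FV|exact: VO].
- by move=> z d d0 dO; rewrite GF; [exact: FO|exact/dO/disc_center].
Qed.

(** A compact set keeps a distance [d] from the complement of [Omega], and the
    poles are of size at most [d^-1] there. *)
Lemma nonextendable_dense Omega V K : open Omega -> V `<=` Omega ->
  outer_dense V Omega -> closure V `&` boundary Omega !=set0 -> exhaustive Omega K ->
  dense [set f : Xspace Omega V K | ~ extendable Omega (Xfun f)].
Proof.
move=> oO VO out mt [Kc Kinc _] O [f Of] oOO.
have [n [e [e0 sO]]] : nbhs f O by exact: open_nbhs_nbhs.
have [cK KO] := Kc n; have [d d0 Hd] := compact_margin cK oO KO.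
have KmKn m : (m < n)%N -> K m `<=` K n.
  move=> mn; rewrite -(subnKC (ltnW mn)).
  elim: (n - m)%N => [|k IH]; first by rewrite addn0.
  by rewrite addnS; apply: subset_trans IH _; exact: Kinc.
have Xf : bdd_holfun Omega V (Xfun f) by exact: set_valP.
pose h := Num.min (e / 2) (e / 2 * d).
have h0 : 0 < h by rewrite lt_min ?mulr_gt0 ?divr_gt0.
have [G [XG nG GV GO]] := nonextendable_approx oO VO out mt Xf h0.
exists (SigSub (mem_set XG) : Xspace Omega V K); split=> //.
apply: sO; split=> [m mn|]; apply: supnorm_lt => // z.
- move=> /(KmKn m mn) Kz; rewrite -(ler_pM2r d0).
  apply: le_trans (GO z d d0 (Hd z Kz)) _.
  by rewrite /h ge_min lexx orbT.
- by move=> /GV /le_trans; apply; rewrite /h ge_min lexx.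
Qed.

(** There are countably many tests, and each fails on an open set: the disc on
    which Cauchy's estimates are applied lies in a member of the exhaustion. *)
Lemma nonextendable_Gdelta Omega V K : open Omega -> exhaustive Omega K ->
  Gdelta [set f : Xspace Omega V K | ~ extendable Omega (Xfun f)].
Proof.
move=> oO [Kc Kinc Kex].
have dX (f : Xspace Omega V K) : derivable_in (Xfun f) Omega.
  by have [[]] : bdd_holfun Omega V (Xfun f) by exact: set_valP.
pose T n : set (Xspace Omega V K) := [set f | forall x, unpickle n = Some x ->
  admissible Omega x -> test_fails (Xfun f) x].
exists T; last first.
  apply/seteqP; split=> f.
    by move=> /(nonextendableP oO (dX f)) H n _ x _; exact: H.
  move=> H; apply/(nonextendableP oO (dX f)) => x.
  by apply: (H (pickle x)) => //; rewrite pickleK.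
move=> n; rewrite openE => f Tf; rewrite /interior.
have [[x [nx adm]]|nx] := pselect (exists x, unpickle n = Some x /\ admissible Omega x);
  last first.
  by exists 0%N, 1; split=> // g _ x nx' adm; case: nx; exists x.
have [Oq r0 _] := adm; set q := test_center x in Oq *.
have [a a0 Ha] := inner_radius oO Oq.
pose D := rect (complex.Re q - a) (complex.Re q + a) (complex.Im q - a) (complex.Im q + a).
have ball_in (u v : R) : (u - a <= v <= u + a) = (`|v - u| <= a).
  by rewrite ler_norml [v - u <= a]lerBlDl lerBrDl.
have [m Km] : exists m, D `<=` K m.
  apply: Kex; first exact: compact_rect.
  move=> z [z1 z2]; apply: (Ha z); last exact: disc_center.
  apply: le_trans (normc_le_ReIm _) _; rewrite !raddfB mulr_natl mulr2n.
  by apply: lerD; rewrite -ball_in.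
have a20 : 0 < a / 2 by rewrite divr_gt0.
have DO z : normc (z - q) <= 2 * (a / 2) -> D z.
  rewrite mulrCA divff// mulr1 => zq; split; rewrite ball_in -raddfB.
    exact: le_trans (Re_le_normc _) zq.
  exact: le_trans (Im_le_normc _) zq.
have [|e e0 He] := coef_unbounded_open (dX f) r0 a20 _ (Tf x nx adm).
  by move=> z /DO/Km; have [_] := Kc m; apply.
exists m.+1, e; split=> // g [gK _] y; rewrite nx => -[<-] _.
apply: He => // z /DO/Km zK; exact: (le_supnorm (gK m (ltnSn m)) zK).
Qed.

End FunctionSpace.

Unset Implicit Arguments.

Theorem theorem3p1 (R : realType) (Omega V : set (Cplx R))
  (dOmega : domain Omega) (oV : open V) (sV : V `<=` Omega)
  (meet : closure V `&` boundary Omega !=set0)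
  (outer : forall zeta, (closure V `&` boundary Omega) zeta ->
     exists w : nat -> Cplx R,
       (forall n, (~` closure Omega) (w n)) /\ w @ \oo --> zeta) :
  domain_of_holomorphy (bdd_holfun Omega V) Omega /\
  forall K : nat -> set (Cplx R), exhaustive Omega K ->
    dense [set f : Xspace Omega V K | ~ extendable Omega (Xfun f)] /\
    Gdelta [set f : Xspace Omega V K | ~ extendable Omega (Xfun f)].
Proof.
have [_ oO _] := dOmega.
have out : outer_dense V Omega.
  move=> z /outer[w [nw /cvg_normcP cw]] e /cw[N _ HN].
  by exists (w N); [exact: nw|exact: (HN N (leqnn N))].
split=> [|K exK]; last first.
  by split; [exact: nonextendable_dense|exact: nonextendable_Gdelta].
have X0 : bdd_holfun Omega V (fun=> 0).
  split; first by split=> // z _; exact: derivable_cst.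
  by apply/bounded_normcP; exists 0 => z _; rewrite ComplexField.Normc.normc0.
have [G [XG nG _ _]] := nonextendable_approx oO sV out meet X0 ltr01.
by exists G.
Qed.
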